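(* Let $\Omega$ be a locally compact space. For a Banach module $\Gamma$ over $\mathrm{C}_0(\Omega)$ the following are equivalent. (a) $\Gamma$ is an AM-module over $\mathrm{C}_0(\Omega)$. (b) $\Gamma$ admits a $\mathrm{U}_0(\Omega)$-valued norm. If these assertions hold, then the $\mathrm{U}_0(\Omega)$-valued norm is unique and given by $$|s|(x)=\inf\{\|fs\| : f\in\mathrm{C}_0(\Omega)_+\text{ with }f(x)=1\}$$ for $x\in\Omega$ and $s\in\Gamma$.
   Context: All vector spaces are over a fixed field $\mathbb{K}\in\{\mathbb{R},\mathbb{C}\}$; locally compact spaces are Hausdorff; $\mathrm{C}_0(\Omega)$ is the algebra of continuous $\mathbb{K}$-valued functions vanishing at infinity, $\mathrm{C}_0(\Omega)_+$ its non-negative elements. A Banach module over $\mathrm{C}_0(\Omega)$ is a Banach space $\Gamma$ which is a $\mathrm{C}_0(\Omega)$-module with $\|fs\|\le\|f\|\|s\|$; always assumed non-degenerate, i.e. $\Gamma=\overline{\mathrm{lin}}\{fs:f\in\mathrm{C}_0(\Omega),s\in\Gamma\}$. It is an AM-module if for each $s\in\Gamma$ the submodule $\Gamma_s=\overline{\mathrm{C}_0(\Omega)s}$, which is a Banach lattice with positive cone $\overline{\mathrm{C}_0(\Omega)_+s}$, is an AM-space; equivalently $\max(\|f_1s\|,\|f_2s\|)=\|(f_1\vee f_2)s\|$ for all $f_1,f_2\in\mathrm{C}_0(\Omega)_+$ and $s\in\Gamma$. $\mathrm{U}_0(\Omega)$ is the set of upper semicontinuous $f\colon\Omega\to\mathbb{R}$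 such that for every $\varepsilon>0$ there is a compact $L\subset\Omega$ with $|f(x)|\le\varepsilon$ for $x\notin L$; $\mathrm{U}_0(\Omega)_+$ is its subset of non-negative functions, with the sup norm and pointwise order. A $\mathrm{U}_0(\Omega)$-valued norm on $\Gamma$ is a map $|\cdot|\colon\Gamma\to\mathrm{U}_0(\Omega)_+$ with (i) $\||s|\|=\|s\|$, (ii) $|fs|=|f|\cdot|s|$, (iii) $|s_1+s_2|\le|s_1|+|s_2|$ for all $s,s_1,s_2\in\Gamma$ and $f\in\mathrm{C}_0(\Omega)$. *)

(* Defs.v *)
From HB Require Import structures.
From mathcomp Require Import all_boot all_order all_algebra.
From mathcomp Require Import all_classical all_reals all_analysis.
From mathcomp.real_closed Require Import complex.

Set Implicit Arguments.
Unset Strict Implicit.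
Unset Printing Implicit Defensive.

Import Order.TTheory GRing.Theory Num.Theory.
Import numFieldNormedType.Exports.

Local Open Scope classical_set_scope.
Local Open Scope ring_scope.

(* The field K is [scalar_field R k], with [k] ranging over the two cases
   K = R and K = C = R[i]. *)
Inductive scalar_kind := RealScalars | ComplexScalars.

Definition scalar_field (R : realType) (k : scalar_kind) : numFieldType :=
  match k with
  | RealScalars => R : numFieldType
  | ComplexScalars => R[i] : numFieldType
  end.

Definition re {R : realType} {k : scalar_kind} : scalar_field R k -> R :=
  match k return scalar_field R k -> R with
  | RealScalars => fun z => z
  | ComplexScalars => fun z => complex.Re z
  end.

(* The imaginary unit, which is 0 when K = R, so that [r + im *: r'] covers
   real vectors (K = R) and complexifications (K = C) at the same time. *)
Definition im (R : realType) (k : scalar_kind) : scalar_field R k :=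
  match k return scalar_field R k with
  | RealScalars => (0 : R)
  | ComplexScalars => ('i%C : R[i])
  end.

(* The norm of a normed space over [scalar_field R k] takes its values in
   [scalar_field R k]; they are real, and [rnorm] reads them in [R]. *)
Definition rnorm {R : realType} {k : scalar_kind}
  {V : normedModType (scalar_field R k)} (v : V) : R := re `|v|.

Section VanishingFunctions.
Context {Omega : topologicalType} {K : numFieldType}.

Definition vanishes_at_infinity (f : Omega -> K) :=
  forall e : K, 0 < e ->
    exists2 L : set Omega, compact L & forall x, ~ L x -> `|f x| <= e.

Definition c0 : {pred Omega -> K} :=
  mem [set f : Omega -> K | continuous f /\ vanishes_at_infinity f].

Lemma c0P (f : Omega -> K) :
  f \in c0 <-> continuous f /\ vanishes_at_infinity f.
Proof. by split=> [/set_mem|H]; [|apply/mem_set]. Qed.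

Lemma c0_submod_closed : submod_closed c0.
Proof.
split=> [|a f g /c0P[cf vf] /c0P[cg vg]]; apply/c0P; split.
- exact: cst_continuous.
- by move=> e e0; exists set0; [exact: compact0|move=> x _; rewrite normr0 ltW].
- move=> x; apply: continuousD; last exact: cg.
  by apply: continuousZ; [exact: cst_continuous|exact: cf].
- move=> e e0; have a0 : 0 < `|a| + 1 by rewrite ltr_wpDl.
  have e20 : 0 < e / 2 by rewrite divr_gt0.
  have [L cL fL] := vf (e / 2 / (`|a| + 1)) (divr_gt0 e20 a0).
  have [M cM gM] := vg (e / 2) e20.
  exists (L `|` M); first exact: compactU.
  move=> x /not_orP[Lx Mx]; apply: le_trans (ler_normD _ _) _.
  rewrite [leRHS](splitr e) lerD ?gM// normrM.
  rewrite -[e / 2](divfK (lt0r_neq0 a0)) mulrC ler_pM ?fL//.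
  by rewrite lerDl.
Qed.

Lemma c0_mulr_closed (f g : Omega -> K) :
  f \in c0 -> g \in c0 -> (fun x => f x * g x) \in c0.
Proof.
move=> /c0P[cf vf] /c0P[cg vg]; apply/c0P; split.
- by move=> x; apply: continuousM; [exact: cf|exact: cg].
- move=> e e0; have [L cL fL] := vf e e0; have [M cM gM] := vg 1 ltr01.
  exists (L `|` M); first exact: compactU.
  move=> x /not_orP[Lx Mx].
  by rewrite normrM -[e]mulr1 ler_pM ?fL ?gM.
Qed.

HB.instance Definition _ :=
  GRing.isSubmodClosed.Build K (Omega -> K) c0 c0_submod_closed.

End VanishingFunctions.

Record C0 (Omega : topologicalType) (K : numFieldType) := MkC0 {
  C0_fun :> Omega -> K;
  C0_in : C0_fun \in c0
}.

Section C0Algebra.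
Context {Omega : topologicalType} {K : numFieldType}.

HB.instance Definition _ := [isSub for @C0_fun Omega K].
HB.instance Definition _ := [Choice of C0 Omega K by <:].
HB.instance Definition _ := [SubChoice_isSubLmodule of C0 Omega K by <:].

Definition C0_mul (f g : C0 Omega K) : C0 Omega K :=
  MkC0 (c0_mulr_closed (C0_in f) (C0_in g)).

(* On R[i], [0 <= z] says that [z] is real and non-negative. *)
Definition C0_nonneg : set (C0 Omega K) := [set f | forall x, 0 <= f x].

End C0Algebra.

Definition sup_norm {R : realType} {T : Type} (f : T -> R) : R :=
  sup (range (fun x => `|f x|)).

Definition C0_norm {R : realType} {k : scalar_kind} {Omega : topologicalType}
  (f : C0 Omega (scalar_field R k)) : R := sup_norm (fun x => re `|f x|).

Definition lin {K : numFieldType} {V : lmodType K} (A : set V) : set V :=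
  [set v | exists n (c : 'I_n -> K) (a : 'I_n -> V),
     (forall i, A (a i)) /\ v = \sum_(i < n) c i *: a i].

Record banach_module (R : realType) (k : scalar_kind) (Omega : topologicalType)
    (Gamma : completeNormedModType (scalar_field R k)) := BanachModule {
  mact :> C0 Omega (scalar_field R k) -> Gamma -> Gamma;
  mact_linear_fun : forall s, linear (mact^~ s);
  mact_linear_vec : forall f, linear (mact f);
  mact_mul : forall f g s, mact (C0_mul f g) s = mact f (mact g s);
  mact_norm : forall f s, rnorm (mact f s) <= C0_norm f * rnorm s;
  mact_nondegenerate :
    closure (lin [set t | exists f s, t = mact f s]) = setT
}.

Section BanachLattice.
Context {R : realType} {k : scalar_kind} {V : normedModType (scalar_field R k)}.
Implicit Types (E P A : set V) (u v w z m : V).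

Definition cone_le P u v := P (v - u).

(* The ordered real vector space spanned by the cone [P]. *)
Definition real_part P : set V := [set w | exists u v, P u /\ P v /\ w = u - v].

Definition is_lub P A m :=
  real_part P m /\ (forall a, A a -> cone_le P a m) /\
  forall b, real_part P b -> (forall a, A a -> cone_le P a b) -> cone_le P m b.

Record real_banach_lattice P : Prop := RealBanachLattice {
  rbl_closed : closed (real_part P);
  rbl_zero : P 0;
  rbl_add : forall u v, P u -> P v -> P (u + v);
  rbl_scale : forall (a : scalar_field R k) u, 0 <= a -> P u -> P (a *: u);
  rbl_proper : forall u, P u -> P (- u) -> u = 0;
  rbl_join : forall u v, real_part P u -> real_part P v ->
    exists w, is_lub P [set u; v] w;
  rbl_norm : forall u v u' v',
    is_lub P [set u; - u] u' -> is_lub P [set v; - v] v' ->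
    real_part P u -> real_part P v ->
    cone_le P u' v' -> rnorm u <= rnorm v
}.

(* [m] is the supremum over [`|c| = 1] of the real parts of [c *: z]; for
   K = R this is the supremum of [z] and [- z]. *)
Definition is_modulus P z m :=
  is_lub P [set r | real_part P r /\ exists c r', `|c| = 1 /\
                    real_part P r' /\ c *: z = r + im R k *: r'] m.

(* For K = C, [E] is a complex Banach lattice, i.e. the complexification of the
   real Banach lattice [real_part P] with the norm of z equal to that of |z|.
   For K = R, [im R k = 0] and [E] is just [real_part P]. *)
Record banach_lattice E P : Prop := BanachLattice {
  bl_real : real_banach_lattice P;
  bl_split : forall z, E z <->
    exists u v, real_part P u /\ real_part P v /\ z = u + im R k *: v;
  bl_direct : forall u v, real_part P u -> real_part P v ->
    u = im R k *: v -> u = 0;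
  bl_norm : forall z m, E z -> is_modulus P z m -> rnorm z = rnorm m
}.

Definition AM_space E P :=
  banach_lattice E P /\
  forall u v w, P u -> P v -> is_lub P [set u; v] w ->
    rnorm w = Num.max (rnorm u) (rnorm v).

End BanachLattice.

Section Modules.
Context {R : realType} {k : scalar_kind} {Omega : topologicalType}.
Context {Gamma : completeNormedModType (scalar_field R k)}.
Variable M : banach_module Omega Gamma.

Definition orbit_submodule (s : Gamma) : set Gamma :=
  closure [set t | exists f, t = M f s].

Definition orbit_cone (s : Gamma) : set Gamma :=
  closure [set t | exists2 f, C0_nonneg f & t = M f s].

Definition AM_module := forall s, AM_space (orbit_submodule s) (orbit_cone s).

Definition upper_semicontinuous (f : Omega -> R) :=
  lower_semicontinuous (fun x => (- f x)%:E).

Definition U0 : set (Omega -> R) :=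
  [set f | upper_semicontinuous f /\ vanishes_at_infinity f].

Definition U0_nonneg : set (Omega -> R) :=
  [set f | U0 f /\ forall x, 0 <= f x].

Record U0_valued_norm (N : Gamma -> Omega -> R) : Prop := U0ValuedNorm {
  U0norm_val : forall s, U0_nonneg (N s);
  U0norm_norm : forall s, sup_norm (N s) = rnorm s;
  U0norm_act : forall (f : C0 Omega (scalar_field R k)) s x,
    N (M f s) x = re `|f x| * N s x;
  U0norm_triangle : forall s1 s2 x, N (s1 + s2) x <= N s1 x + N s2 x
}.

End Modules.

(* Main.v *)
Require Import Defs.
From HB Require Import structures.
From mathcomp Require Import all_boot all_order all_algebra.
From mathcomp Require Import all_classical all_reals all_analysis.
From mathcomp Require Import ring lra.
From mathcomp.real_closed Require Import complex.

Set Implicit Arguments.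
Unset Strict Implicit.
Unset Printing Implicit Defensive.

Import Order.TTheory GRing.Theory Num.Theory.
Import numFieldNormedType.Exports.

Local Open Scope classical_set_scope.
Local Open Scope ring_scope.

(**
Both directions rest on one fact about an arbitrary Banach module: the norm of
[M f s] depends monotonically on the pointwise modulus of [f]
([mact_dominated]).  Indeed, if |a| <= |b|, then [a] is a uniform limit of
functions [h * b] with |h| <= 1.  Consequently a contraction
[phi : C_0(Omega, K) -> C_0(Omega, R)] for the pointwise modulus extends to the
closed submodule generated by [s], in the form of an estimate
|w - phi(f) s| <= |u - f s| valid for all [f] ([extension]).  Applied to the
positive part, the real part, the imaginary part and the modulus, this turns
the pointwise lattice operations of C_0(Omega) into lattice operations of the
closed submodule: for every Banach module the real part of this submodule is a
Banach lattice, in which the supremum of [F s] and [G s] is [(F \/ G) s]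
([orbit_real_lattice], [lub_act]), and for K = C the submodule is its
complexification as a vector space ([orbit_split], [orbit_direct]).

From a U_0-valued norm [N] to an AM-module: the norm of [f s] is the supremum
over [x] of |f x| * N s x, so that the AM property [orbit_AM] is the identity
for suprema of real functions.  What remains of the Banach lattice axioms is
that the norm of [z] equals that of its modulus.  The limit [m] of |f| s, for
[f s] tending to [z], has the right norm; it is the supremum of the real parts
of [c z], |c| = 1, because in the estimates one may choose the phase [c]
depending on the point [x] at which [N] is evaluated ([modulus_lub]).

From an AM-module to a U_0-valued norm: take the infimum of the formula as a
definition ([localnorm]).  All axioms except one follow from domination,
Urysohn functions and approximate units.  The exception is that the sup norm of
[localnorm s] is not smaller than the norm of [s] ([rnorm_le_localnorm]).  If
[localnorm s < b] everywhere, then a compact set is covered by finitely many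
sets [{F > 1}] with [F s] of norm less than [b]; by the AM property the maximum
of these [F] has the same bound, and it dominates an approximate unit on that
compact set.

Uniqueness is the formula itself ([U0norm_localnorm]): [N s x <= |F s|] for
each [F >= 0] with [F x = 1], and upper semicontinuity makes the bound sharp
for [F] with small support around [x].
*)

(** * Real and complex scalars *)

Section Scalars.
Context {R : realType} {k : scalar_kind}.
Local Notation K := (scalar_field R k).
Implicit Types (z w : K) (a b : R).

Definition ofR a : K :=
  match k return scalar_field R k with
  | RealScalars => (a : R)
  | ComplexScalars => (a%:C%C : R[i])
  end.

Definition cj z : K :=
  match k return scalar_field R k -> scalar_field R k with
  | RealScalars => fun x => x
  | ComplexScalars => fun x => (conjc x : R[i])
  end z.

(** For K = R this is 0, as [im R k] is; hence the decomposition [re_imagE]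
holds for both fields. *)
Definition imag z : R := re (- im R k * z).

Lemma ofR_zmod : zmod_morphism ofR.
Proof. by rewrite /ofR; case: k => a b //; rewrite -rmorphB. Qed.

Lemma ofR_monoid : monoid_morphism ofR.
Proof.
by rewrite /ofR; case: k; split => // a b; rewrite -rmorphM.
Qed.

HB.instance Definition _ := GRing.isZmodMorphism.Build R K ofR ofR_zmod.
HB.instance Definition _ := GRing.isMonoidMorphism.Build R K ofR ofR_monoid.

Lemma ofRK a : re (ofR a) = a.
Proof. by rewrite /ofR /re; case: k. Qed.

Lemma ler_ofR a b : (ofR a <= ofR b) = (a <= b).
Proof. by rewrite /ofR; case: k => //; rewrite lecR. Qed.

Lemma ltr_ofR a b : (ofR a < ofR b) = (a < b).
Proof. by rewrite /ofR; case: k => //; rewrite ltcR. Qed.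

Lemma ofR_re z : 0 <= z -> ofR (re z) = z.
Proof.
rewrite /ofR /re; case: k z => //= z z0; apply: RRe_real; exact: ger0_real.
Qed.

Lemma normr_ofR a : `|ofR a| = ofR `|a|.
Proof.
rewrite /ofR; case: k => //=; rewrite normc_def /= expr0n /= addr0.
by rewrite sqrtr_sqr.
Qed.

Lemma mod_ofR a : re `|ofR a| = `|a|.
Proof. by rewrite normr_ofR ofRK. Qed.

Lemma reB z w : re (z - w) = re z - re w.
Proof. by rewrite /re; case: k z w => //= -[? ?] [? ?]. Qed.

Lemma re0 : re (0 : K) = 0.
Proof. by rewrite -[0]subr0 reB subrr. Qed.

Lemma reN z : re (- z) = - re z.
Proof. by rewrite -sub0r reB re0 sub0r. Qed.

Lemma reD z w : re (z + w) = re z + re w.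
Proof. by rewrite -{1}[w]opprK reB reN opprK. Qed.

Lemma re_ofRM a z : re (ofR a * z) = a * re z.
Proof.
rewrite /re /ofR; case: k z => [//|[x y]] /=; by rewrite mul0r subr0.
Qed.

Lemma ofR_mod z : ofR (re `|z|) = `|z|.
Proof. exact: ofR_re. Qed.

Lemma re_ge0 z : 0 <= z -> 0 <= re z.
Proof. by move=> z0; rewrite -ler_ofR ofR_re// rmorph0. Qed.

Lemma re_gt0 z : 0 < z -> 0 < re z.
Proof. by move=> z0; rewrite -ltr_ofR ofR_re ?ltW// rmorph0. Qed.

Lemma mod_ge0 z : 0 <= re `|z|.
Proof. exact: re_ge0. Qed.

Lemma modM z w : re `|z * w| = re `|z| * re `|w|.
Proof. by rewrite normrM -{1}(ofR_mod z) re_ofRM. Qed.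

Lemma modD z w : re `|z + w| <= re `|z| + re `|w|.
Proof. by rewrite -ler_ofR rmorphD /= !ofR_mod ler_normD. Qed.

Lemma modB z w : re `|z - w| = re `|w - z|.
Proof. by rewrite distrC. Qed.

Lemma mod0 : re `|0 : K| = 0.
Proof. by rewrite normr0 re0. Qed.

Lemma mod_eq0 z : (re `|z| == 0) = (z == 0).
Proof.
apply/eqP/eqP => [e|->]; last exact: mod0.
by apply/normr0_eq0; rewrite -ofR_mod e rmorph0.
Qed.

Lemma re_le_mod z : `|re z| <= re `|z|.
Proof.
rewrite /re; case: k z => //= z.
rewrite -lecR; apply: le_trans (normc_ge_Re z) _.
by rewrite (RRe_real (normr_real z)).
Qed.

Lemma cjM z : z * cj z = ofR (re `|z| ^+ 2).
Proof.
rewrite rmorphXn /= ofR_mod /cj; case: k z => [|] z.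
  by rewrite -normrX ger0_norm ?sqr_ge0// expr2.
by rewrite sqr_normc.
Qed.

Lemma mod_cj z : re `|cj z| = re `|z|.
Proof. by rewrite /cj; case: k z => [//|] z; congr re; exact: normcJ. Qed.

Lemma cjB z w : cj (z - w) = cj z - cj w.
Proof. by rewrite /cj; case: k z w => [//|] z w; rewrite rmorphB. Qed.

(** The pointwise form of the identity |z| = sup of Re (c z) over |c| = 1. *)
Lemma phase z : exists2 c : K, `|c| = 1 & re (c * z) = re `|z|.
Proof.
have [->|z0] := eqVneq z 0.
  by exists 1; rewrite ?normr1// mulr0 normr0.
have nz0 : re `|z| != 0 by rewrite mod_eq0.
exists (ofR (re `|z|)^-1 * cj z).
  rewrite -ofR_mod modM mod_cj mod_ofR ger0_norm ?invr_ge0 ?mod_ge0//.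
  by rewrite mulVf// rmorph1.
by rewrite -mulrA re_ofRM mulrC [cj z * z]mulrC cjM ofRK expr2 mulfK.
Qed.

Lemma mod_im : re `|im R k| <= 1.
Proof.
rewrite /im /re; case: k => /=; first by rewrite normr0.
by rewrite expr0n add0r expr1n sqrtr1.
Qed.

Lemma re_imM a : re (im R k * ofR a) = 0.
Proof.
rewrite /re /im /ofR; case: k => /=; first by rewrite mul0r.
by rewrite !mul0r mul1r subr0.
Qed.

Lemma re_imagE z : z = ofR (re z) + im R k * ofR (imag z).
Proof.
rewrite /imag /re /ofR /im; case: k z => [|] z; first by rewrite mul0r addr0.
case: z => x y; rewrite [LHS]complexE /=; congr (_ + _); congr (_ * _%:C%C).
by rewrite oppr0 mul0r add0r mulN1r opprK.
Qed.

Lemma imagB z w : imag (z - w) = imag z - imag w.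
Proof. by rewrite /imag mulrBr reB. Qed.

Lemma imag_le_mod z : `|imag z| <= re `|z|.
Proof.
apply: le_trans (re_le_mod _) _; rewrite modM normrN.
by rewrite ler_piMl ?mod_ge0// mod_im.
Qed.

End Scalars.

(** * Constructions in the algebra of functions vanishing at infinity *)

Section Lipschitz.
Context {R : realType} {k l : scalar_kind}.

Lemma contraction_continuous (h : scalar_field R k -> scalar_field R l) :
  (forall z w, re `|h z - h w| <= re `|z - w|) -> continuous h.
Proof.
move=> hL z A /nbhs_ballP[e /= e0 eA]; apply/nbhs_ballP.
exists (ofR (re e)).
  by rewrite /= -[ltLHS](rmorph0 (@ofR R k)) ltr_ofR re_gt0.
move=> w; rewrite -!ball_normE /= => zw; apply: eA.
rewrite -ball_normE /= -ofR_mod -(ofR_re (ltW e0)) ltr_ofR.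
by apply: le_lt_trans (hL _ _) _; rewrite -(@ltr_ofR R k) ofR_mod.
Qed.

End Lipschitz.

Section C0Builders.
Context {R : realType} {Omega : topologicalType}.

Lemma c0_dominated {k l : scalar_kind} (F : Omega -> scalar_field R k)
    (f : C0 Omega (scalar_field R l)) :
  continuous F -> (forall x, re `|F x| <= re `|f x|) -> F \in c0.
Proof.
move=> cF Ff; apply/c0P; split => // e e0.
have [_ vf] := (c0P _).1 (C0_in f).
have [|L cL fL] := vf (ofR (re e)).
  by rewrite -[ltLHS](rmorph0 (@ofR R l)) ltr_ofR re_gt0.
exists L => // x /fL; rewrite -ofR_mod ler_ofR => fx.
by rewrite -ofR_mod -(ofR_re (ltW e0)) ler_ofR (le_trans (Ff x)).
Qed.

Lemma continuous_C0 {K : numFieldType} (f : C0 Omega K) : continuous f.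
Proof. by have [] := (c0P _).1 (C0_in f). Qed.

Lemma C0DE {K : numFieldType} (f g : C0 Omega K) x : (f + g) x = f x + g x.
Proof. by []. Qed.

Lemma C0BE {K : numFieldType} (f g : C0 Omega K) x : (f - g) x = f x - g x.
Proof. by []. Qed.

Lemma C0ZE {K : numFieldType} (a : K) (f : C0 Omega K) x : (a *: f) x = a * f x.
Proof. by []. Qed.

Section Contraction.
Context {k l : scalar_kind} (h : scalar_field R k -> scalar_field R l).
Hypotheses (h0 : h 0 = 0)
  (hL : forall z w, re `|h z - h w| <= re `|z - w|).

(** Maps fixing 0 that do not increase distances act on C_0 by composition; this
produces real parts, moduli, conjugates and truncations at once. *)
Lemma c0_contraction (f : C0 Omega (scalar_field R k)) : (h \o f) \in c0.
Proof.
apply: (@c0_dominated _ _ _ f) => x.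
  apply: continuous_comp; first exact: continuous_C0.
  exact: contraction_continuous.
by have := hL (f x) 0; rewrite h0 !subr0.
Qed.

End Contraction.

Section Maps.
Context {k : scalar_kind}.
Local Notation K := (scalar_field R k).
Implicit Types (f g : C0 Omega K) (F G : C0 Omega R).

Lemma ofR_contraction (a b : R) :
  re `|ofR a - ofR b : K| <= @re R RealScalars `|a - b|.
Proof. by rewrite -rmorphB /= mod_ofR. Qed.

Definition embC0 F : C0 Omega K :=
  MkC0 (@c0_contraction RealScalars k ofR (rmorph0 _) ofR_contraction F).

Lemma cj_contraction (a b : K) : re `|cj a - cj b| <= re `|a - b|.
Proof. by rewrite -cjB mod_cj. Qed.

Lemma cj0 : cj 0 = 0 :> K.
Proof. by rewrite -[X in cj X](subrr 0) cjB subrr. Qed.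

Definition starC0 f : C0 Omega K := MkC0 (c0_contraction cj0 cj_contraction f).

Lemma re_contraction (a b : K) :
  @re R RealScalars `|re a - re b| <= re `|a - b|.
Proof. by rewrite -reB re_le_mod. Qed.

Definition reC0 f : C0 Omega R :=
  MkC0 (@c0_contraction k RealScalars re re0 re_contraction f).

Lemma imag_contraction (a b : K) :
  @re R RealScalars `|imag a - imag b| <= re `|a - b|.
Proof. by rewrite -imagB imag_le_mod. Qed.

Lemma imag0 : imag (0 : K) = 0.
Proof. by rewrite -[X in imag X](subrr 0) imagB subrr. Qed.

Definition imC0 f : C0 Omega R :=
  MkC0 (@c0_contraction k RealScalars imag imag0 imag_contraction f).

Lemma mod_contraction (a b : K) :
  @re R RealScalars `|re `|a| - re `|b| | <= re `|a - b|.
Proof.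
have h1 := modD (a - b) b; have h2 := modD (b - a) a.
rewrite /= ler_norml; rewrite (modB b a) in h2; rewrite !subrK in h1 h2.
by apply/andP; split; lra.
Qed.

Definition absC0 f : C0 Omega R :=
  MkC0 (@c0_contraction k RealScalars _ mod0 mod_contraction f).

End Maps.

Lemma maxr_continuous (F G : Omega -> R) : continuous F -> continuous G ->
  continuous (fun x => Num.max (F x) (G x)).
Proof. by move=> cF cG x; apply: continuous_max; [exact: cF|exact: cG]. Qed.

Lemma c0_max (F G : C0 Omega R) : (fun x => Num.max (F x) (G x)) \in c0.
Proof.
apply: (@c0_dominated RealScalars RealScalars _
  (@absC0 RealScalars F + @absC0 RealScalars G)).
  by apply: maxr_continuous; apply: continuous_C0.
move=> x; change (`|Num.max (F x) (G x)| <= `| `|F x| + `|G x| |).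
rewrite [leRHS]ger0_norm ?addr_ge0//.
by rewrite /Num.max; case: ifP => _; rewrite ?lerDl ?lerDr.
Qed.

Definition maxC0 F G : C0 Omega R := MkC0 (c0_max F G).

End C0Builders.

Arguments embC0 {R Omega} k F.

(** * The real-valued norm *)

Section RealNorm.
Context {R : realType} {k : scalar_kind}.
Context {V : normedModType (scalar_field R k)}.
Implicit Types (u v : V) (A : set V).

Lemma ofR_rnorm v : ofR (rnorm v) = `|v|.
Proof. by rewrite ofR_re. Qed.

Lemma rnorm_ge0 v : 0 <= rnorm v.
Proof. exact: re_ge0. Qed.

Lemma rnormD u v : rnorm (u + v) <= rnorm u + rnorm v.
Proof. by rewrite -(@ler_ofR R k) rmorphD /= !ofR_rnorm ler_normD. Qed.

Lemma rnormN v : rnorm (- v) = rnorm v.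
Proof. by rewrite /rnorm normrN. Qed.

Lemma rnormB u v : rnorm (u - v) = rnorm (v - u).
Proof. by rewrite /rnorm distrC. Qed.

Lemma rnormZ (a : scalar_field R k) v : rnorm (a *: v) = re `|a| * rnorm v.
Proof. by rewrite /rnorm normrZ -{1}(ofR_mod a) re_ofRM. Qed.

Lemma rnorm0 : rnorm (0 : V) = 0.
Proof. by rewrite /rnorm normr0 re0. Qed.

Lemma rnorm_eq0 v : rnorm v = 0 -> v = 0.
Proof. by move=> v0; apply/normr0_eq0; rewrite -ofR_rnorm v0 rmorph0. Qed.

Lemma rnorm_dist u v w : rnorm (u - w) <= rnorm (u - v) + rnorm (v - w).
Proof. by rewrite -(subrKA v) (le_trans (rnormD _ _)). Qed.

Lemma rnorm_le_dist u v : rnorm u <= rnorm v + rnorm (u - v).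
Proof. by rewrite -{1}(subrK v u) addrC rnormD. Qed.

Lemma scaled_eps (c e : R) : 0 <= c -> 0 < e -> exists2 d, 0 < d & c * d < e.
Proof.
move=> c0 e0; have d0 : 0 < c + 1 by rewrite ltr_wpDl.
exists (e / (c + 1)); first exact: divr_gt0.
by rewrite mulrCA gtr_pMr// ltr_pdivrMr// mul1r ltrDl.
Qed.

Lemma ler_addMgt0 (c x y : R) : 0 <= c ->
  (forall e, 0 < e -> x <= y + c * e) -> x <= y.
Proof.
move=> c0 xy; apply/ler_addgt0Pr => e /(scaled_eps c0)[d d0 /ltW cd].
by rewrite (le_trans (xy d d0))// lerD2l.
Qed.

Lemma rnorm_small (c : R) v : 0 <= c ->
  (forall e, 0 < e -> rnorm v <= c * e) -> v = 0.
Proof.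
move=> c0 vs; apply: rnorm_eq0; apply/eqP; rewrite eq_le rnorm_ge0 andbT.
by apply: (ler_addMgt0 c0) => e e0; rewrite add0r vs.
Qed.

Lemma closure_rnormP A u : closure A u <->
  forall e : R, 0 < e -> exists2 v, A v & rnorm (u - v) < e.
Proof.
split=> [Au e e0|Au B /nbhs_ballP[e /= e0 eB]].
  have [|v [Av]] := Au (ball u (ofR e)).
    by apply: nbhsx_ballx; rewrite -[ltLHS](rmorph0 (@ofR R k)) ltr_ofR.
  by rewrite -ball_normE /= -ofR_rnorm ltr_ofR; exists v.
have [v Av uv] := Au (re e) (re_gt0 e0).
exists v; split => //; apply: eB; rewrite -ball_normE /=.
by rewrite -ofR_rnorm -(ofR_re (ltW e0)) ltr_ofR.
Qed.

End RealNorm.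

(** * Supremum norms *)

Section SupNorm.
Context {R : realType} {T : Type}.

Lemma sup_norm_le (f : T -> R) c : 0 <= c -> (forall x, `|f x| <= c) ->
  sup_norm f <= c.
Proof.
move=> c0 fc; rewrite /sup_norm.
have [->|/set0P A0] := eqVneq (range (fun x => `|f x|)) set0.
  by rewrite sup0.
by apply: ge_sup => // _ [x _ <-].
Qed.

Lemma sup_norm_ge0 (f : T -> R) : 0 <= sup_norm f.
Proof.
rewrite /sup_norm; set A := (X in sup X).
have [hs|hs] := pselect (has_sup A); last by rewrite (sup_out hs).
have [[_ [x _ _]] _] := hs; apply: le_trans (normr_ge0 (f x)) _.
by apply: ub_le_sup; [case: hs|exists x].
Qed.

End SupNorm.

Lemma C0_norm_le {R : realType} {k : scalar_kind} {Omega : topologicalType}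
    (f : C0 Omega (scalar_field R k)) c :
  0 <= c -> (forall x, re `|f x| <= c) -> C0_norm f <= c.
Proof.
by move=> c0 fc; apply: sup_norm_le => // x; rewrite ger0_norm ?mod_ge0.
Qed.

(** * Domination in a Banach module *)

Section Module.
Context {R : realType} {k : scalar_kind} {Omega : topologicalType}.
Context {Gamma : completeNormedModType (scalar_field R k)}.
Variable M : banach_module Omega Gamma.
Implicit Types (f g : C0 Omega (scalar_field R k)) (F G : C0 Omega R).
Implicit Types (s t u v w : Gamma).

Lemma mactD f g s : M (f + g) s = M f s + M g s.
Proof. by have := mact_linear_fun M s 1 f g; rewrite !scale1r. Qed.

Lemma mactB f g s : M (f - g) s = M f s - M g s.
Proof.
have := mact_linear_fun M s (-1) g f; rewrite !scaleN1r => e.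
by rewrite addrC e addrC.
Qed.

Lemma mact0 s : M 0 s = 0.
Proof. by rewrite -(subrr 0) mactB subrr. Qed.

Lemma mactZ a f s : M (a *: f) s = a *: M f s.
Proof. by have := mact_linear_fun M s a f 0; rewrite !addr0 mact0 addr0. Qed.

Lemma mactBr f s t : M f (s - t) = M f s - M f t.
Proof.
have := mact_linear_vec M f (-1) t s; rewrite !scaleN1r => e.
by rewrite addrC e addrC.
Qed.

Lemma mactr0 f : M f 0 = 0.
Proof. by rewrite -[X in M f X](subrr 0) mactBr subrr. Qed.

Lemma mactDr f s t : M f (s + t) = M f s + M f t.
Proof. by have := mact_linear_vec M f 1 s t; rewrite !scale1r. Qed.

Lemma mact_bounded f s c : 0 <= c -> (forall x, re `|f x| <= c) ->
  rnorm (M f s) <= c * rnorm s.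
Proof.
move=> c0 fc; apply: le_trans (mact_norm M f s) _.
by rewrite ler_wpM2r ?rnorm_ge0// C0_norm_le.
Qed.

(** A regularisation of the quotient [f / g]: multiplied by [g] it gives back
[f * |g|^2 / (|g|^2 + e^2)], which is close to [f] where |f| <= |g|. *)
Lemma quot_c0 f g (e : R) : 0 < e ->
  (fun x => f x * cj (g x) * ofR (re `|g x| ^+ 2 + e ^+ 2)^-1) \in c0.
Proof.
move=> e0.
have cj_g : continuous (fun x => cj (g x)).
  have := @continuous_C0 _ _ (starC0 g). exact.
have cD : continuous (fun x => f x * cj (g x)).
  move=> x; apply: continuousM; first exact: continuous_C0.
  exact: cj_g.
have cg : continuous (absC0 g) by exact: continuous_C0.
have cr : continuous (fun x => (absC0 g x ^+ 2 + e ^+ 2)^-1).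
  move=> x. apply: (@continuousV R Omega (fun x => absC0 g x ^+ 2 + e ^+ 2)).
    by rewrite gt_eqF// ltr_wpDl ?sqr_ge0// exprn_gt0.
  apply: continuousD; last exact: cst_continuous.
  by apply: (@continuousM R Omega (absC0 g) (absC0 g)); exact: cg.
apply: (@c0_dominated _ _ k k _ (ofR e^-1 *: f)) => x.
  apply: (@continuousM (scalar_field R k) Omega (fun x => f x * cj (g x))).
    exact: cD.
  apply: continuous_comp; first exact: cr.
  by apply: (@contraction_continuous _ RealScalars k); exact: ofR_contraction.
rewrite C0ZE !modM mod_cj !mod_ofR.
set m := re `|g x|; have m0 : 0 <= m by exact: mod_ge0.
have d0 : 0 < m ^+ 2 + e ^+ 2 by rewrite ltr_wpDl ?sqr_ge0// exprn_gt0.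
rewrite [`|_^-1|]gtr0_norm ?invr_gt0// [`|e^-1|]gtr0_norm ?invr_gt0//.
rewrite -mulrA [leRHS]mulrC.
rewrite ler_wpM2l ?mod_ge0// ler_pdivrMr// ler_pdivlMl//; nra.
Qed.

(** With [h] the regularised quotient of [quot_c0], |h| <= 1 and
|f - h g| = |f| e^2 / (|g|^2 + e^2) <= e, so |f s| <= |g s| + e |s|. *)
Lemma mact_dominated f g s : (forall x, re `|f x| <= re `|g x|) ->
  rnorm (M f s) <= rnorm (M g s).
Proof.
move=> fg; apply: (ler_addMgt0 (rnorm_ge0 s)) => e e0.
pose h := MkC0 (quot_c0 f g e0).
have d0 x : 0 < re `|g x| ^+ 2 + e ^+ 2.
  by rewrite ltr_wpDl ?sqr_ge0// exprn_gt0.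
have hE x :
    (C0_mul h g) x = ofR (re `|g x| ^+ 2 / (re `|g x| ^+ 2 + e ^+ 2)) * f x.
  rewrite /= rmorphM /= -cjM; ring.
have h1 x : re `|h x| <= 1.
  rewrite /= !modM mod_cj mod_ofR [`|_^-1|]gtr0_norm ?invr_gt0//.
  rewrite ler_pdivrMr// mul1r.
  by have := fg x; have := mod_ge0 (f x); nra.
have fh x : re `|(f - C0_mul h g) x| <= e.
  rewrite C0BE hE -[X in X - _]mul1r -mulrBl.
  rewrite -(rmorph1 (@ofR R k)) -rmorphB modM.
  rewrite mod_ofR -[1](divff (lt0r_neq0 (d0 x))) -mulrBl addrC addKr.
  rewrite [`|_ / _|]ger0_norm ?divr_ge0 ?sqr_ge0 ?(ltW (d0 x))//.
  rewrite mulrAC ler_pdivrMr//.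
  have := fg x; have := mod_ge0 (f x).
  move: (re `|f x|) (re `|g x|) => a b a0 ab.
  rewrite [leLHS](_ : _ = e * (e * a)); last by ring.
  by rewrite ler_wpM2l ?(ltW e0)//; have := sqr_ge0 (b - e); nra.
apply: le_trans (rnorm_le_dist _ (M (C0_mul h g) s)) _.
rewrite lerD//; last by rewrite -mactB mulrC mact_bounded// ltW.
by rewrite mact_mul -[leRHS]mul1r mact_bounded.
Qed.

End Module.

(** * Real functions acting on the module *)

Section RealNormCalculus.
Context {R : realType} {k : scalar_kind}.
Context {V : normedModType (scalar_field R k)}.
Implicit Types (a b c d : V).

Lemma rnorm_distD a b c d :
  rnorm ((a + b) - (c + d)) <= rnorm (a - c) + rnorm (b - d).
Proof. by rewrite opprD addrACA rnormD. Qed.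

Lemma rnorm_distB a b c d :
  rnorm ((a - b) - (c - d)) <= rnorm (a - c) + rnorm (b - d).
Proof.
rewrite opprD addrACA opprK (le_trans (rnormD _ _))// lerD2l.
by rewrite [- b + d]addrC rnormB.
Qed.

Lemma rnorm_distS a b c d :
  rnorm (b - (c + d)) <= rnorm (a - c) + rnorm (b - a - d).
Proof. by rewrite -{1}(subrK a b) [_ + a]addrC rnorm_distD. Qed.

End RealNormCalculus.

Section RealAction.
Context {R : realType} {k : scalar_kind} {Omega : topologicalType}.
Context {Gamma : completeNormedModType (scalar_field R k)}.
Variable M : banach_module Omega Gamma.
Implicit Types (f g : C0 Omega (scalar_field R k)) (F G : C0 Omega R).
Implicit Types (s t u v w : Gamma).

Definition act F s : Gamma := M (embC0 k F) s.

Lemma embD F G : embC0 k (F + G) = embC0 k F + embC0 k G.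
Proof. by apply/val_inj/funext => x /=; rewrite rmorphD. Qed.

Lemma embB F G : embC0 k (F - G) = embC0 k F - embC0 k G.
Proof. by apply/val_inj/funext => x /=; rewrite rmorphB. Qed.

Lemma actD F G s : act (F + G) s = act F s + act G s.
Proof. by rewrite /act embD mactD. Qed.

Lemma actB F G s : act (F - G) s = act F s - act G s.
Proof. by rewrite /act embB mactB. Qed.

Lemma act0 s : act 0 s = 0.
Proof. by rewrite -(subrr 0) actB subrr. Qed.

Lemma actN F s : act (- F) s = - act F s.
Proof. by rewrite -[- F]sub0r actB act0 sub0r. Qed.

Lemma actZ a F s : act (a *: F) s = ofR a *: act F s.
Proof.
rewrite -mactZ; congr (M _ s); apply/val_inj/funext => x /=.
by rewrite rmorphM.
Qed.

Lemma act_dominated F G s : (forall x, `|F x| <= `|G x|) ->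
  rnorm (act F s) <= rnorm (act G s).
Proof. by move=> FG; apply: mact_dominated => x; rewrite /= !mod_ofR. Qed.

Lemma act_le F G s : (forall x, 0 <= F x) -> (forall x, F x <= G x) ->
  rnorm (act F s) <= rnorm (act G s).
Proof.
move=> F0 FG; apply: act_dominated => x.
by rewrite !ger0_norm// (le_trans (F0 x)).
Qed.

Lemma act_le_mact F f s : (forall x, `|F x| <= re `|f x|) ->
  rnorm (act F s) <= rnorm (M f s).
Proof. by move=> Ff; apply: mact_dominated => x; rewrite /= mod_ofR. Qed.

Lemma rnorm_absC0 f s : rnorm (act (absC0 f) s) = rnorm (M f s).
Proof.
apply/eqP; rewrite eq_le; apply/andP; split; apply: mact_dominated => x.
  by rewrite /= mod_ofR ger0_norm ?mod_ge0.
by rewrite /= mod_ofR [leRHS]ger0_norm ?mod_ge0.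
Qed.

Lemma nonneg_emb f : C0_nonneg f -> f = embC0 k (absC0 f).
Proof.
move=> f0; apply/val_inj/funext => x /=.
by rewrite ofR_mod ger0_norm // f0.
Qed.

Lemma emb_nonneg F : (forall x, 0 <= F x) -> C0_nonneg (embC0 k F).
Proof. by move=> F0 x; rewrite /= -[leLHS](rmorph0 (@ofR R k)) ler_ofR. Qed.

Lemma orbitP s u : orbit_submodule M s u <->
  forall e : R, 0 < e -> exists f, rnorm (u - M f s) < e.
Proof.
rewrite /orbit_submodule closure_rnormP.
split=> H e e0; have := H e e0.
  by case=> _ [f ->] uf; exists f.
by case=> f uf; exists (M f s) => //; exists f.
Qed.

Lemma coneP s u : orbit_cone M s u <-> forall e : R, 0 < e ->
  exists2 F : C0 Omega R, (forall x, 0 <= F x) & rnorm (u - act F s) < e.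
Proof.
rewrite /orbit_cone closure_rnormP.
split=> H e e0; have := H e e0.
  case=> _ [f f0 ->] uf; exists (absC0 f); first by move=> x; exact: mod_ge0.
  by rewrite /act -nonneg_emb.
case=> F F0 uf; exists (act F s) => //; exists (embC0 k F) => //.
exact: emb_nonneg.
Qed.

Lemma cone_act s F : (forall x, 0 <= F x) -> orbit_cone M s (act F s).
Proof.
by move=> F0; apply/coneP => e e0; exists F => //; rewrite subrr rnorm0.
Qed.

(** By domination, [f s |-> phi(f) s] is a contraction, and it extends to the
closure by completeness.  The estimate for all [f] at once lets later arguments
choose a single approximation [f] of [u] and use several such extensions with
it. *)
Lemma extension (phi : C0 Omega (scalar_field R k) -> C0 Omega R) s u :
  (forall f g x, `|phi f x - phi g x| <= re `|f x - g x|) ->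
  orbit_submodule M s u ->
  exists w, forall f, rnorm (w - act (phi f) s) <= rnorm (u - M f s).
Proof.
move=> phiL /orbitP Eu.
have phiM f g : rnorm (act (phi f) s - act (phi g) s) <= rnorm (M f s - M g s).
  by rewrite -actB -mactB; apply: act_le_mact => x; rewrite C0BE phiL.
pose B (e : R) := [set act (phi f) s | f in [set f | rnorm (u - M f s) < e]].
(* The values of phi at approximations of u form a Cauchy filter base. *)
pose Fl := filter_from [set e : R | 0 < e] B.
have FlP : ProperFilter Fl.
  apply: filter_from_proper; last first.
    by move=> e /= /Eu[f uf]; exists (act (phi f) s); exists f.
  apply: filter_from_filter; first by exists 1 => /=.
  move=> a b /= a0 b0; exists (Num.min a b); first by rewrite lt_min a0.
  by move=> _ [f /= + <-]; rewrite lt_min => /andP[fa fb]; split; exists f.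
have : cvg Fl.
  apply: cauchy_cvg; apply: cauchy_exP => e e0.
  have e20 : 0 < re e / 2 by rewrite divr_gt0 ?re_gt0.
  have [f uf] := Eu _ e20; exists (act (phi f) s); exists (re e / 2) => //.
  move=> _ [g /= ug <-]; rewrite -ball_normE /=.
  rewrite -ofR_rnorm -(ofR_re (ltW e0)) ltr_ofR.
  apply: le_lt_trans (phiM _ _) _.
  apply: le_lt_trans (rnorm_dist _ u _) _.
  by rewrite [ltRHS]splitr ltrD// rnormB.
move=> /cvg_ex[w Flw]; exists w => f.
apply: (@ler_addMgt0 _ 2) => // e e0.
have Be : Fl (B e) by exists e.
have wb : Fl (ball w (ofR e)).
  apply: Flw; apply: nbhsx_ballx.
  by rewrite -[ltLHS](rmorph0 (@ofR R k)) ltr_ofR.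
have [_ [[g /= ug <-]]] := filter_ex (filterI Be wb).
rewrite -ball_normE /= -ofR_rnorm ltr_ofR => wg.
have h1 := rnorm_dist w (act (phi g) s) (act (phi f) s).
have h2 := phiM g f; have h3 := rnorm_dist (M g s) u (M f s).
by rewrite (rnormB (M g s) u) in h3; lra.
Qed.

End RealAction.

(** * The lattice structure of the closed submodule generated by a section *)

Section OrbitLattice.
Context {R : realType} {k : scalar_kind} {Omega : topologicalType}.
Context {Gamma : completeNormedModType (scalar_field R k)}.
Variables (M : banach_module Omega Gamma) (s : Gamma).
Implicit Types (f g : C0 Omega (scalar_field R k)) (F G : C0 Omega R).
Implicit Types (u v w : Gamma).
Local Notation E := (orbit_submodule M s).
Local Notation P := (orbit_cone M s).
Local Notation "F '.s'" := (act M F s) (at level 8, format "F '.s'").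

(** Approximation up to a constant multiple of [e] is enough; this spares the
bookkeeping of error terms.  The same holds for [realI] and [orbitI]. *)
Lemma coneI (c : R) u : 0 <= c ->
  (forall e : R, 0 < e -> exists2 F : C0 Omega R,
     (forall x, 0 <= F x) & rnorm (u - F.s) <= c * e) -> P u.
Proof.
move=> c0 H; apply/coneP => e /(scaled_eps c0)[d d0 cd].
by have [F F0 uF] := H d d0; exists F => //; exact: le_lt_trans uF cd.
Qed.

Lemma cone0 : P 0.
Proof. by rewrite -(act0 M s); apply: cone_act. Qed.

Lemma coneD u v : P u -> P v -> P (u + v).
Proof.
move=> /coneP Pu /coneP Pv; apply: (@coneI 2) => // e e0.
have [F F0 uF] := Pu e e0; have [G G0 vG] := Pv e e0.
exists (F + G); first by move=> x; rewrite C0DE addr_ge0.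
by rewrite actD (le_trans (rnorm_distD _ _ _ _))//; lra.
Qed.

Lemma coneZ (a : scalar_field R k) u : 0 <= a -> P u -> P (a *: u).
Proof.
move=> a0 /coneP Pu; apply: (@coneI (re a)); first exact: re_ge0.
move=> e e0; have [F F0 uF] := Pu e e0.
exists (re a *: F); first by move=> x; rewrite C0ZE mulr_ge0// re_ge0.
by rewrite actZ ofR_re// -scalerBr rnormZ ger0_norm// ler_wpM2l ?re_ge0// ltW.
Qed.

(** If [F s] is close to [u] and [G s] to [- u], then [(F + G) s] is small and
dominates [F s]. *)
Lemma cone_proper u : P u -> P (- u) -> u = 0.
Proof.
move=> /coneP Pu /coneP Nu; apply: (@rnorm_small _ _ _ 3) => // e e0.
have [F F0 uF] := Pu e e0; have [G G0 uG] := Nu e e0.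
have FG : rnorm F.s <= rnorm (F + G).s.
  by apply: act_le => // x; rewrite C0DE lerDl.
have h : rnorm (F + G).s <= 2 * e.
  rewrite -rnormN -[- _]add0r -(subrr u) actD.
  by rewrite (le_trans (rnorm_distD _ _ _ _))//; lra.
by have := rnorm_le_dist u F.s; lra.
Qed.

Lemma cone_norm_le u v : P u -> P (v - u) -> rnorm u <= rnorm v.
Proof.
move=> /coneP Pu /coneP Pvu; apply: (@ler_addMgt0 _ 3) => // e e0.
have [F F0 uF] := Pu e e0; have [G G0 vG] := Pvu e e0.
have FG : rnorm F.s <= rnorm (F + G).s.
  by apply: act_le => // x; rewrite C0DE lerDl.
have h : rnorm ((F + G).s - v) <= 2 * e.
  by rewrite rnormB actD; have := rnorm_distS u v F.s G.s; lra.
have h1 := rnorm_le_dist u F.s; have h2 := rnorm_le_dist (F + G).s v.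
by lra.
Qed.

Lemma reC0_emb F : reC0 (embC0 k F) = F.
Proof. by apply/val_inj/funext => x /=; rewrite ofRK. Qed.

Lemma maxr0_contraction (a b : R) : `|Num.max a 0 - Num.max b 0| <= `|a - b|.
Proof.
rewrite /Num.max; case: (ltP a 0) => a0; case: (ltP b 0) => b0.
- by rewrite subrr normr0.
- by rewrite sub0r normrN (ger0_norm b0) ler_normr; apply/orP; right; lra.
- by rewrite subr0 (ger0_norm a0) ler_normr; apply/orP; left; lra.
- by [].
Qed.

Lemma orbit_pos u : E u -> exists w, forall F,
  rnorm (w - (maxC0 F 0).s) <= rnorm (u - F.s).
Proof.
move=> Eu.
have [|w Hw] := @extension _ _ _ _ M (fun f => maxC0 (reC0 f) 0) s u _ Eu.
  move=> f g x; apply: le_trans (maxr0_contraction _ _) _.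
  by rewrite -reB re_le_mod.
by exists w => F; have := Hw (embC0 k F); rewrite reC0_emb.
Qed.

(** The span of the cone is the closure of the real functions times [s]: the
positive part extends, so each limit [u] is the difference of [w], the limit of
the positive parts, and [w - u]. *)
Lemma real_partP u : real_part P u <->
  forall e : R, 0 < e -> exists F, rnorm (u - F.s) < e.
Proof.
split=> [[v [w [/coneP Pv [/coneP Pw ->]]]] e e0|H].
  have e20 : 0 < e / 2 by rewrite divr_gt0.
  have [F _ vF] := Pv _ e20; have [G _ wG] := Pw _ e20.
  exists (F - G); rewrite actB (le_lt_trans (rnorm_distB _ _ _ _))//; lra.
have Eu : E u.
  by apply/orbitP => e /H[F uF]; exists (embC0 k F).
have [w Hw] := orbit_pos Eu; exists w, (w - u); split; last split.
- apply: (@coneI 1) => // e /H[F uF].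
  exists (maxC0 F 0); first by move=> x; rewrite /= le_max lexx orbT.
  by rewrite mul1r (le_trans (Hw F))// ltW.
- apply: (@coneI 2) => // e /H[F uF]; exists (maxC0 F 0 - F).
    by move=> x; rewrite C0BE /= subr_ge0 le_max lexx.
  rewrite actB (le_trans (rnorm_distB _ _ _ _))//.
  by have := Hw F; lra.
- by rewrite opprB addrC subrK.
Qed.

Lemma realI (c : R) u : 0 <= c ->
  (forall e : R, 0 < e -> exists F, rnorm (u - F.s) <= c * e) ->
  real_part P u.
Proof.
move=> c0 H; apply/real_partP => e /(scaled_eps c0)[d d0 cd].
by have [F uF] := H d d0; exists F; exact: le_lt_trans uF cd.
Qed.

Lemma real_orbit u : real_part P u -> E u.
Proof.
move=> /real_partP H; apply/orbitP => e /H[F uF]; by exists (embC0 k F).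
Qed.

Lemma real_cone u : P u -> real_part P u.
Proof.
by move=> Pu; exists u, 0; rewrite subr0; do !split => //; exact: cone0.
Qed.

Lemma real_partB u v : real_part P u -> real_part P v -> real_part P (u - v).
Proof.
move=> /real_partP Pu /real_partP Pv; apply: (@realI 2) => // e e0.
have [F uF] := Pu e e0; have [G vG] := Pv e e0.
by exists (F - G); rewrite actB (le_trans (rnorm_distB _ _ _ _))//; lra.
Qed.

Lemma real_part0 : real_part P 0.
Proof. exact/real_cone/cone0. Qed.

Lemma real_partN u : real_part P u -> real_part P (- u).
Proof.
by move=> Pu; rewrite -sub0r; apply: real_partB => //; exact: real_part0.
Qed.

Lemma closed_real_part : closed (real_part P).
Proof.
move=> u /closure_rnormP Hu; apply: (@realI 2) => // e e0.
have [v /real_partP Pv uv] := Hu e e0; have [F vF] := Pv e e0.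
by exists F; have := rnorm_dist u v F.s; lra.
Qed.

(** [F \/ G = (F - G)^+ + G], and the positive part extends. *)
Lemma orbit_join u v : real_part P u -> real_part P v ->
  exists w, forall F G,
    rnorm (w - (maxC0 F G).s) <= rnorm (u - F.s) + 2 * rnorm (v - G.s).
Proof.
move=> Pu Pv; have [w Hw] := orbit_pos (real_orbit (real_partB Pu Pv)).
exists (w + v) => F G.
have -> : maxC0 F G = maxC0 (F - G) 0 + G.
  apply/val_inj/funext => x.
  change (Num.max (F x) (G x) = Num.max (F x - G x) 0 + G x).
  by rewrite /Num.max subr_lt0; case: ifP => _; rewrite ?add0r ?subrK.
rewrite actD (le_trans (rnorm_distD _ _ _ _))//.
have := Hw (F - G); rewrite actB.
by have := rnorm_distB u v F.s G.s; lra.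
Qed.

(** An upper bound [b] of [u] and [v] is close to both [(F + F') s] and
[(G + G') s] with [F', G' >= 0], hence to the maximum of [F + F'] and [G + G']
times [s], and this maximum is above [F \/ G]. *)
Lemma orbit_join_lub u v w : real_part P u -> real_part P v ->
  (forall F G,
    rnorm (w - (maxC0 F G).s) <= rnorm (u - F.s) + 2 * rnorm (v - G.s)) ->
  is_lub P [set u; v] w.
Proof.
move=> /real_partP Pu /real_partP Pv Hw; split; last split.
- apply: (@realI 3) => // e e0.
  have [F uF] := Pu e e0; have [G vG] := Pv e e0.
  by exists (maxC0 F G); have := Hw F G; lra.
- move=> a [->|->] /=; apply: (@coneI 4) => // e e0;
    have [F uF] := Pu e e0; have [G vG] := Pv e e0.
    exists (maxC0 F G - F).
      by move=> x; rewrite C0BE subr_ge0 /= le_max lexx.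
    by rewrite actB (le_trans (rnorm_distB _ _ _ _))//; have := Hw F G; lra.
  exists (maxC0 F G - G).
    by move=> x; rewrite C0BE subr_ge0 /= le_max lexx orbT.
  by rewrite actB (le_trans (rnorm_distB _ _ _ _))//; have := Hw F G; lra.
- move=> b Pb Hb.
  have /coneP Pbu : P (b - u) by apply: Hb; left.
  have /coneP Pbv : P (b - v) by apply: Hb; right.
  apply: (@coneI 9) => // e e0.
  have [F uF] := Pu e e0; have [G vG] := Pv e e0.
  have [F' F'0 uF'] := Pbu e e0; have [G' G'0 vG'] := Pbv e e0.
  have bF : rnorm (b - (F + F').s) <= 2 * e.
    by rewrite actD; have := rnorm_distS u b F.s F'.s; lra.
  have bG : rnorm (b - (G + G').s) <= 2 * e.
    by rewrite actD; have := rnorm_distS v b G.s G'.s; lra.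
  exists (maxC0 (F + F') (G + G') - maxC0 F G).
    move=> x; rewrite C0BE subr_ge0 /= ge_max !le_max.
    by rewrite lerDl F'0 lerDl G'0 orbT.
  have mF : rnorm ((F + F').s - (maxC0 (F + F') (G + G')).s) <= 4 * e.
    apply: (@le_trans _ _ (rnorm ((F + F').s - (G + G').s))).
      rewrite -!actB; apply: act_dominated => x; rewrite !C0BE [maxC0 _ _ _]/=.
      set a := (F + F') x; set c := (G + G') x.
      by rewrite /Num.max; case: ltP => // _; rewrite subrr normr0.
    have := rnorm_dist (F + F').s b (G + G').s.
    by rewrite (rnormB (F + F').s b); lra.
  rewrite actB (le_trans (rnorm_distB _ _ _ _))//.
  have := Hw F G.
  have := rnorm_dist b (F + F').s (maxC0 (F + F') (G + G')).s.
  by lra.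
Qed.

Lemma is_lub_unique (A : set Gamma) m m' :
  is_lub P A m -> is_lub P A m' -> m = m'.
Proof.
move=> [Pm [mA ml]] [Pm' [mA' ml']]; apply/eqP; rewrite -subr_eq0; apply/eqP.
by apply: cone_proper; [apply: ml'|rewrite opprB; apply: ml].
Qed.

Lemma lub_approx u v w : real_part P u -> real_part P v ->
  is_lub P [set u; v] w -> forall F G,
    rnorm (w - (maxC0 F G).s) <= rnorm (u - F.s) + 2 * rnorm (v - G.s).
Proof.
move=> Pu Pv lw; have [w' Hw'] := orbit_join Pu Pv.
by rewrite (is_lub_unique lw (orbit_join_lub Pu Pv Hw')).
Qed.

(** This identifies the suprema that the AM hypothesis speaks of, which is what
makes it usable. *)
Lemma lub_act F G : is_lub P [set F.s; G.s] (maxC0 F G).s.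
Proof.
have Pr H : real_part P H.s.
  by apply: (@realI 0) => // e e0; exists H; rewrite subrr rnorm0 mul0r.
have [w Hw] := orbit_join (Pr F) (Pr G).
have -> : (maxC0 F G).s = w.
  apply/eqP; rewrite eq_sym -subr_eq0; apply/eqP/rnorm_eq0/eqP.
  rewrite eq_le rnorm_ge0 andbT; apply: le_trans (Hw F G) _.
  by rewrite !subrr rnorm0 mulr0 addr0.
exact: orbit_join_lub.
Qed.

(** The absolute value of [u] is the limit of |F| s, and |F| s has the norm of
[F s]. *)
Lemma rnorm_abs u w : real_part P u -> is_lub P [set u; - u] w ->
  P w /\ rnorm w = rnorm u.
Proof.
move=> Pu lw; have Hw := lub_approx Pu (real_partN Pu) lw.
have {Hw}Hw F : rnorm (w - (maxC0 F (- F)).s) <= 3 * rnorm (u - F.s).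
  apply: le_trans (Hw _ _) _.
  by rewrite actN opprK [- u + _]addrC (rnormB _ u); lra.
have absN F : rnorm (maxC0 F (- F)).s = rnorm F.s.
  have E x : `|(maxC0 F (- F)) x| = `|F x|.
    rewrite /= /Num.max; case: ltP => // _; exact: normrN.
  by apply/eqP; rewrite eq_le !act_dominated// => x; rewrite E.
have /real_partP Hu := Pu; split.
  apply: (@coneI 3) => // e /Hu[F uF]; exists (maxC0 F (- F)).
    move=> x; rewrite /= le_max.
    by case: (leP 0 (F x)) => //= /ltW; rewrite oppr_ge0.
  by have := Hw F; lra.
have main e : 0 < e -> rnorm w <= rnorm u + 4 * e /\ rnorm u <= rnorm w + 4 * e.
  move=> /Hu[F uF]; have := Hw F; have := absN F.
  have h1 := rnorm_le_dist w (maxC0 F (- F)).s.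
  have h2 := rnorm_le_dist u F.s.
  have h3 := rnorm_le_dist (maxC0 F (- F)).s w.
  have h4 := rnorm_le_dist F.s u.
  rewrite (rnormB _ w) in h3; rewrite (rnormB _ u) in h4.
  by move=> *; split; lra.
by apply/eqP; rewrite eq_le; apply/andP; split;
  apply: (@ler_addMgt0 _ 4) => // e /main[].
Qed.

Lemma orbit_real_lattice : real_banach_lattice P.
Proof.
split.
- exact: closed_real_part.
- exact: cone0.
- exact: coneD.
- exact: coneZ.
- exact: cone_proper.
- move=> u v Pu Pv; have [w Hw] := orbit_join Pu Pv.
  by exists w; exact: orbit_join_lub.
- move=> u v u' v' lu lv Pu Pv uv.
  have [Pu' <-] := rnorm_abs Pu lu; have [Pv' <-] := rnorm_abs Pv lv.
  exact: cone_norm_le.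
Qed.

End OrbitLattice.

(** * Real parts, imaginary parts and moduli in the closed submodule *)

Section OrbitComplexification.
Context {R : realType} {k : scalar_kind} {Omega : topologicalType}.
Context {Gamma : completeNormedModType (scalar_field R k)}.
Variables (M : banach_module Omega Gamma) (s : Gamma).
Implicit Types (f g : C0 Omega (scalar_field R k)) (F G : C0 Omega R).
Implicit Types (u v w z : Gamma).
Local Notation E := (orbit_submodule M s).
Local Notation P := (orbit_cone M s).
Local Notation "F '.s'" := (act M F s) (at level 8, format "F '.s'").

Lemma mact_re_im f : M f s = (reC0 f).s + im R k *: (imC0 f).s.
Proof.
rewrite /act -mactZ -mactD; congr (M _ s); apply/val_inj/funext => x.
exact: re_imagE.
Qed.

Lemma orbitI (c : R) u : 0 <= c ->
  (forall e : R, 0 < e -> exists f, rnorm (u - M f s) <= c * e) -> E u.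
Proof.
move=> c0 H; apply/orbitP => e /(scaled_eps c0)[d d0 cd].
by have [f uf] := H d d0; exists f; exact: le_lt_trans uf cd.
Qed.

Lemma orbitZ (c : scalar_field R k) u : E u -> E (c *: u).
Proof.
move=> /orbitP Eu; apply: (@orbitI (re `|c|)); first exact: mod_ge0.
move=> e /Eu[f uf]; exists (c *: f).
by rewrite mactZ -scalerBr rnormZ ler_wpM2l ?mod_ge0// ltW.
Qed.

Lemma orbit_re u : E u -> exists w, forall f,
  rnorm (w - (reC0 f).s) <= rnorm (u - M f s).
Proof.
by apply: extension => f g x; rewrite /= -reB re_le_mod.
Qed.

Lemma orbit_im u : E u -> exists w, forall f,
  rnorm (w - (imC0 f).s) <= rnorm (u - M f s).
Proof.
by apply: extension => f g x; rewrite /= -imagB imag_le_mod.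
Qed.

Lemma orbit_mod u : E u -> exists w, forall f,
  rnorm (w - (absC0 f).s) <= rnorm (u - M f s).
Proof.
by apply: extension => f g x; exact: (mod_contraction (f x) (g x)).
Qed.

Lemma approx_real (phi : C0 Omega (scalar_field R k) -> C0 Omega R) z w :
  E z -> (forall f, rnorm (w - (phi f).s) <= rnorm (z - M f s)) ->
  real_part P w.
Proof.
move=> /orbitP Ez Hw; apply/real_partP => e /Ez[f zf].
by exists (phi f); exact: le_lt_trans (Hw f) zf.
Qed.

Lemma rnorm_imZ u : rnorm (im R k *: u) <= rnorm u.
Proof. by rewrite rnormZ ler_piMl ?rnorm_ge0// mod_im. Qed.

Lemma rnorm_dist_im a b c d :
  rnorm ((a + im R k *: b) - (c + im R k *: d) : Gamma) <=
  rnorm (a - c) + rnorm (b - d).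
Proof.
rewrite (le_trans (rnorm_distD _ _ _ _))// lerD2l -scalerBr.
exact: rnorm_imZ.
Qed.

Lemma split_eq z u v : E z ->
  (forall f, rnorm (u - (reC0 f).s) <= rnorm (z - M f s)) ->
  (forall f, rnorm (v - (imC0 f).s) <= rnorm (z - M f s)) ->
  z = u + im R k *: v.
Proof.
move=> /orbitP Ez Hu Hv; apply/eqP; rewrite -subr_eq0; apply/eqP.
apply: (@rnorm_small _ _ _ 3) => // e /Ez[f zf].
have h1 := rnorm_dist z (M f s) (u + im R k *: v).
have h2 := rnorm_dist_im u v (reC0 f).s (imC0 f).s.
rewrite -mact_re_im (rnormB _ (M f s)) in h2.
by have := Hu f; have := Hv f; lra.
Qed.

Lemma orbit_split z : E z <->
  exists u v, real_part P u /\ real_part P v /\ z = u + im R k *: v.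
Proof.
split=> [Ez|[u [v [/real_partP Pu [/real_partP Pv ->]]]]].
  have [u Hu] := orbit_re Ez; have [v Hv] := orbit_im Ez.
  exists u, v; split; first exact: approx_real Hu.
  by split; [exact: approx_real Hv|exact: split_eq].
apply: (@orbitI 2) => // e e0.
have [F uF] := Pu e e0; have [G vG] := Pv e e0.
exists (embC0 k F + im R k *: embC0 k G); rewrite mactD mactZ.
by have := rnorm_dist_im u v F.s G.s; rewrite /act in uF vG *; lra.
Qed.

Lemma rnorm_re_le f F G :
  rnorm ((reC0 f).s - F.s) <= rnorm (M f s - (F.s + im R k *: G.s)).
Proof.
rewrite -actB /act -mactZ -mactD -mactB; apply: act_le_mact => x.
rewrite !C0BE C0DE C0ZE /=; apply: le_trans (re_le_mod _).
by rewrite reB reD ofRK re_imM addr0.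
Qed.

Lemma orbit_direct u v : real_part P u -> real_part P v ->
  u = im R k *: v -> u = 0.
Proof.
move=> /real_partP Pu /real_partP Pv uv.
apply: (@rnorm_small _ _ _ 3) => // e e0.
have [F uF] := Pu e e0; have [G vG] := Pv e e0.
have := rnorm_re_le 0 F (- G); rewrite mact0 actN scalerN.
have -> : reC0 (0 : C0 Omega (scalar_field R k)) = 0.
  by apply/val_inj/funext => x; exact: re0.
rewrite act0 !sub0r !rnormN => h.
have h1 := rnorm_distB u (im R k *: v) F.s (im R k *: G.s).
rewrite -scalerBr uv subrr sub0r rnormN -uv in h1.
have h2 := rnorm_imZ (v - G.s).
have := rnorm_le_dist u F.s.
lra.
Qed.

(** The real part of [c z] is approximated by Re (c f) s, and
Re (c f) <= |f|. *)
Lemma modulus_ub z m c r r' : E z ->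
  (forall f, rnorm (m - (absC0 f).s) <= rnorm (z - M f s)) ->
  `|c| = 1 -> real_part P r -> real_part P r' ->
  c *: z = r + im R k *: r' -> P (m - r).
Proof.
move=> /orbitP Ez Hm c1 /real_partP Pr /real_partP Pr' cz.
have mc : re `|c| = 1 by rewrite c1 -(rmorph1 (@ofR R k)) ofRK.
apply: (@coneI _ _ _ _ M s 5) => // e e0.
have [f zf] := Ez e e0; have [G rG] := Pr e e0; have [H rH] := Pr' e e0.
exists (absC0 f - reC0 (c *: f)).
  move=> x; rewrite C0BE subr_ge0; change (re (c * f x) <= re `|f x|).
  by rewrite -[re `|f x|]mul1r -mc -modM (le_trans _ (re_le_mod _))// ler_norm.
rewrite actB (le_trans (rnorm_distB _ _ _ _))//.
have h1 := Hm f.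
have h2 := rnorm_re_le (c *: f) G H.
have h3 := rnorm_dist (M (c *: f) s) (c *: z) (G.s + im R k *: H.s).
have h4 := rnorm_dist_im r r' G.s H.s.
rewrite -cz in h4.
have h5 : rnorm (M (c *: f) s - c *: z) = rnorm (z - M f s).
  by rewrite mactZ -scalerBr rnormZ mc mul1r rnormB.
have h6 := rnorm_dist r G.s (reC0 (c *: f)).s.
rewrite (rnormB G.s) in h6.
lra.
Qed.

End OrbitComplexification.

(** * From a U_0-valued norm to the AM property *)

Section NormToAM.
Context {R : realType} {k : scalar_kind} {Omega : topologicalType}.
Context {Gamma : completeNormedModType (scalar_field R k)}.
Variables (M : banach_module Omega Gamma) (N : Gamma -> Omega -> R).
Hypothesis HN : U0_valued_norm M N.
Implicit Types (f g : C0 Omega (scalar_field R k)) (F G : C0 Omega R).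
Implicit Types (s t u v w z : Gamma).

Lemma U0norm_ge0 s x : 0 <= N s x.
Proof. by have [_] := U0norm_val HN s. Qed.

(** The supremum of an unbounded set is 0 by convention; this case is harmless
because it would force [s = 0], hence [N s = 0]. *)
Lemma U0norm_le s x : N s x <= rnorm s.
Proof.
rewrite -(U0norm_norm HN) /sup_norm.
have [hs|hs] := pselect (has_sup (range (fun x => `|N s x|))).
  by apply: (le_trans (ler_norm _)); apply: ub_le_sup; [case: hs|exists x].
have := U0norm_norm HN s; rewrite /sup_norm (sup_out hs) => s0.
have -> : s = M 0 s by rewrite mact0; apply/rnorm_eq0.
by rewrite (U0norm_act HN) mod0 mul0r.
Qed.

Lemma rnorm_le_U0norm s c : 0 <= c -> (forall x, N s x <= c) -> rnorm s <= c.
Proof.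
move=> c0 H; rewrite -(U0norm_norm HN); apply: sup_norm_le => // x.
by rewrite ger0_norm// U0norm_ge0.
Qed.

Lemma U0norm_actR F s x : N (act M F s) x = `|F x| * N s x.
Proof. by rewrite (U0norm_act HN) /= mod_ofR. Qed.

Lemma rnorm_maxC0 s F G : (forall x, 0 <= F x) -> (forall x, 0 <= G x) ->
  rnorm (act M (maxC0 F G) s) = Num.max (rnorm (act M F s)) (rnorm (act M G s)).
Proof.
move=> F0 G0; apply/eqP; rewrite eq_le; apply/andP; split; last first.
  rewrite ge_max !act_le// => x; by rewrite /= le_max lexx ?orbT.
apply: rnorm_le_U0norm => [|x]; first by rewrite le_max rnorm_ge0.
rewrite U0norm_actR /= le_max.
have hF := U0norm_le (act M F s) x; have hG := U0norm_le (act M G s) x.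
rewrite !U0norm_actR in hF hG.
by rewrite /Num.max; case: ifP => _; rewrite ?hF ?hG ?orbT.
Qed.

Lemma orbit_AM s u v w : orbit_cone M s u -> orbit_cone M s v ->
  is_lub (orbit_cone M s) [set u; v] w ->
  rnorm w = Num.max (rnorm u) (rnorm v).
Proof.
move=> Pu Pv lw; have Hw := lub_approx (real_cone Pu) (real_cone Pv) lw.
have main e : 0 < e -> `|rnorm w - Num.max (rnorm u) (rnorm v)| <= 4 * e.
  move=> e0; have /coneP/(_ e e0)[F F0 uF] := Pu.
  have /coneP/(_ e e0)[G G0 vG] := Pv.
  have := Hw F G; have := rnorm_maxC0 s F0 G0.
  set m := act M _ s => mE wm.
  have h1 := rnorm_le_dist w m; have h2 := rnorm_le_dist m w.
  have h3 := rnorm_le_dist u (act M F s).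
  have h4 := rnorm_le_dist (act M F s) u.
  have h5 := rnorm_le_dist v (act M G s).
  have h6 := rnorm_le_dist (act M G s) v.
  rewrite (rnormB _ w) in h2; rewrite (rnormB _ u) in h4.
  rewrite (rnormB _ v) in h6; rewrite ler_norml.
  move: mE; rewrite /Num.max; case: ltP => ?; case: ltP => ? mE;
    apply/andP; split; lra.
apply/eqP; rewrite -subr_eq0 -normr_eq0 eq_le normr_ge0 andbT.
by apply: (@ler_addMgt0 _ 4) => // e e0; rewrite add0r main.
Qed.

(** Let [b] be an upper bound, approximated by [G s].  At a point [x], choosing
[c] with Re (c f x) = |f x| bounds (|f x| - G x)^+ * N s x by [3 * e],
uniformly in [x]; hence (|f| - G)^+ s is small and [b - m] is close to
(G - |f|)^+ s. *)
Lemma modulus_lub s z m : orbit_submodule M s z ->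
  (forall f, rnorm (m - act M (absC0 f) s) <= rnorm (z - M f s)) ->
  is_modulus (orbit_cone M s) z m.
Proof.
move=> Ez Hm; split; first exact: approx_real Hm.
split=> [r [Pr [c [r' [c1 [Pr' cz]]]]]|b Pb Hb].
  exact: modulus_ub Hm _ _ _ cz.
apply: (@coneI _ _ _ _ M s 5) => // e e0.
have /orbitP/(_ e e0)[f zf] := Ez.
have /real_partP/(_ e e0)[G bG] := Pb.
pose D := maxC0 (absC0 f - G) 0.
have key : rnorm (act M D s) <= 3 * e.
  apply: rnorm_le_U0norm => [|x]; first lra.
  have [c c1 cf] := phase (f x).
  have mc : re `|c| = 1 by rewrite c1 -(rmorph1 (@ofR R k)) ofRK.
  have Ecz := orbitZ (c := c) Ez.
  have [r Hr] := orbit_re Ecz; have [r' Hr'] := orbit_im Ecz.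
  have Pbr : orbit_cone M s (b - r).
    apply: Hb; split; first exact: approx_real Hr.
    exists c, r'; split=> //; split; first exact: approx_real Hr'.
    exact: split_eq Ecz Hr Hr'.
  have /coneP/(_ e e0)[Q Q0 bQ] := Pbr.
  have h : rnorm (act M (G - reC0 (c *: f) - Q) s) <= 3 * e.
    rewrite !actB.
    have h1 := rnorm_distB (act M G s) (act M (reC0 (c *: f)) s) b r.
    have h2 := rnorm_dist (act M G s - act M (reC0 (c *: f)) s) (b - r)
      (act M Q s).
    have h3 := Hr (c *: f).
    rewrite mactZ -scalerBr rnormZ mc mul1r in h3.
    rewrite (rnormB _ b) (rnormB _ r) in h1.
    lra.
  apply: le_trans h; apply: le_trans (U0norm_le _ x).
  rewrite !U0norm_actR ler_wpM2r ?U0norm_ge0//.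
  change (`|Num.max (re `|f x| - G x) 0| <= `|G x - re (c * f x) - Q x|).
  rewrite cf; have := Q0 x; move: (re `|f x|) (G x) (Q x) => a b' q q0.
  rewrite ler_normr /Num.max; case: ltP => h0.
    rewrite normr0; apply/orP.
    by case: (leP 0 (b' - a - q)) => ?; [left|right]; lra.
  by rewrite ger0_norm//; apply/orP; right; lra.
(* (G - |f|)^+ is G - |f| plus the small part D. *)
exists (maxC0 (G - absC0 f) 0); first by move=> x; rewrite /= le_max lexx orbT.
have -> : maxC0 (G - absC0 f) 0 = G - absC0 f + D.
  apply/val_inj/funext => x.
  change (Num.max (G x - re `|f x|) 0 =
    G x - re `|f x| + Num.max (re `|f x| - G x) 0).
  by rewrite /Num.max; case: ltP => ?; case: ltP => ?; lra.
rewrite actD actB.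
have h1 := rnorm_distB b m (act M G s) (act M (absC0 f) s).
have h2 := rnorm_distD (b - m) 0 (act M G s - act M (absC0 f) s) (act M D s).
rewrite addr0 sub0r rnormN in h2.
by have := Hm f; lra.
Qed.

Lemma rnorm_modulus s z m : orbit_submodule M s z ->
  is_modulus (orbit_cone M s) z m -> rnorm z = rnorm m.
Proof.
move=> Ez lm; have [w Hw] := orbit_mod Ez.
rewrite (is_lub_unique lm (modulus_lub Ez Hw)).
have main e : 0 < e -> rnorm z <= rnorm w + 2 * e /\ rnorm w <= rnorm z + 2 * e.
  have /orbitP Ez' := Ez => /Ez'[f zf]; have := Hw f; have := rnorm_absC0 M f s.
  have h1 := rnorm_le_dist w (act M (absC0 f) s).
  have h2 := rnorm_le_dist z (M f s).
  have h3 := rnorm_le_dist (act M (absC0 f) s) w.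
  have h4 := rnorm_le_dist (M f s) z.
  rewrite (rnormB _ w) in h3; rewrite (rnormB _ z) in h4.
  by move=> *; split; lra.
by apply/eqP; rewrite eq_le; apply/andP; split;
  apply: (@ler_addMgt0 _ 2) => // e /main[].
Qed.

Lemma U0norm_AM_module : AM_module M.
Proof.
move=> s; split; last exact: orbit_AM.
split.
- exact: orbit_real_lattice.
- exact: orbit_split.
- exact: orbit_direct.
- by move=> z m; exact: rnorm_modulus.
Qed.

End NormToAM.

(** * The local norm and the uniqueness of U_0-valued norms *)

Section LocalNorm.
Context {R : realType} {k : scalar_kind} {Omega : topologicalType}.
Hypothesis hausdorff_Omega : hausdorff_space Omega.
Hypothesis lc_Omega : locally_compact [set: Omega].

(** Urysohn's lemma; intersecting [U] with a compact neighbourhood makes the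
function vanish at infinity. *)
Lemma peak_function (x : Omega) (U : set Omega) : nbhs x U ->
  exists F : C0 Omega R, [/\ forall y, 0 <= F y <= 1, F x = 1 &
    forall y, ~ U y -> F y = 0].
Proof.
move=> xU; have [//|L] := @lc_Omega x; rewrite withinET => xL [cL clL].
pose B := ~` (U `&` L)°.
have clB : closed B by apply: open_closedC; exact: open_interior.
have nBx : ~ B x by move=> /(_ (filterI xU xL)).
have sepB := @locally_compact_completely_regular Omega R lc_Omega
  hausdorff_Omega x B clB nBx.
pose h := Urysohn [set x] B : Omega -> R.
have h01 y : 0 <= h y <= 1.
  have : (`[0, 1]%classic : set R) (h y).
    by apply: (@Urysohn_range _ _ [set x] B); exists y.
  by rewrite /= in_itv.
have hx : h x = 0 by apply: (Urysohn_sub0 sepB); exists x.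
have hB y : B y -> h y = 1 by move=> By; apply: (Urysohn_sub1 sepB); exists y.
have hUL y : ~ (U `&` L) y -> h y = 1.
  by move=> nUL; apply: hB => /interior_subset.
have F_c0 : (fun y => 1 - h y) \in @c0 Omega R.
  apply/c0P; split.
    move=> y; apply: continuousB; first exact: cst_continuous.
    exact: Urysohn_continuous.
  move=> e e0; exists L => // y nLy; rewrite hUL ?subrr ?normr0 ?ltW//.
  by case.
exists (MkC0 F_c0); split => /= [y||y nUy].
- by have /andP[h0 h1] := h01 y; apply/andP; split; lra.
- by rewrite hx subr0.
- by rewrite hUL ?subrr//; case.
Qed.

Context {Gamma : completeNormedModType (scalar_field R k)}.
Variable M : banach_module Omega Gamma.
Implicit Types (f g : C0 Omega (scalar_field R k)) (F G : C0 Omega R).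
Implicit Types (s t : Gamma) (x y : Omega).

Definition localnorm s x : R :=
  inf [set rnorm (M f s) | f in
        [set f : C0 Omega (scalar_field R k) | C0_nonneg f /\ f x = 1]].

Lemma localnorm_le s x F : (forall y, 0 <= F y) -> F x = 1 ->
  localnorm s x <= rnorm (act M F s).
Proof.
move=> F0 Fx; apply: ge_inf.
  by exists 0 => _ [f _ <-]; exact: rnorm_ge0.
exists (embC0 k F) => //; split; first exact: emb_nonneg.
by rewrite /= Fx rmorph1.
Qed.

Lemma localnorm_ge s x c :
  (forall F, (forall y, 0 <= F y) -> F x = 1 -> c <= rnorm (act M F s)) ->
  c <= localnorm s x.
Proof.
move=> H; apply: lb_le_inf.
  have [F [F01 Fx _]] := @peak_function x setT filterT.
  exists (rnorm (act M F s)); exists (embC0 k F) => //; split.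
    by apply: emb_nonneg => y; have /andP[] := F01 y.
  by rewrite /= Fx rmorph1.
move=> _ [f [f0 fx] <-]; rewrite (nonneg_emb f0); apply: H.
  by move=> y; exact: mod_ge0.
by rewrite /= fx normr1 -(rmorph1 (@ofR R k)) ofRK.
Qed.

(** The infimum is over a nonempty set by [peak_function]. *)
Lemma localnorm_lt s x c : localnorm s x < c ->
  exists F, [/\ forall y, 0 <= F y, F x = 1 & rnorm (act M F s) < c].
Proof.
apply: contraPP => /forallNP H; apply/negP; rewrite -leNgt.
apply: localnorm_ge => F F0 Fx; rewrite leNgt; apply/negP => Fc.
by apply: (H F).
Qed.

Lemma localnorm_ge0 s x : 0 <= localnorm s x.
Proof. by apply: localnorm_ge => F _ _; exact: rnorm_ge0. Qed.

(** Near [x] upper semicontinuity gives [N s <= N s x + e]; for a peak function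
[F] supported there, the norm of [F s], which is the supremum of [F * N s], is
at most [N s x + e]. *)
Lemma U0norm_localnorm (N : Gamma -> Omega -> R) s x :
  U0_valued_norm M N -> N s x = localnorm s x.
Proof.
move=> HN; apply/eqP; rewrite eq_le; apply/andP; split.
  apply: localnorm_ge => F _ Fx; have := U0norm_le HN (act M F s) x.
  by rewrite (U0norm_actR HN) Fx normr1 mul1r.
apply/ler_addgt0Pr => e e0.
have [[usc _] _] := U0norm_val HN s.
have [|V xV HV] := usc x (- (N s x + e)); first by rewrite lte_fin; lra.
have [F [F01 Fx FV]] := peak_function xV.
apply: (@le_trans _ _ (rnorm (act M F s))).
  by apply: localnorm_le => // y; have /andP[] := F01 y.
have Ne : 0 <= N s x + e by rewrite addr_ge0 ?(U0norm_ge0 HN)// ltW.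
apply: (rnorm_le_U0norm HN) => // y; rewrite (U0norm_actR HN).
have [Vy|nVy] := pselect (V y); last by rewrite FV// normr0 mul0r.
have := HV _ Vy; rewrite lte_fin ltrN2 => /ltW Ny.
have /andP[Fy0 Fy1] := F01 y; have N0 := U0norm_ge0 HN s y.
by rewrite ger0_norm// (le_trans _ Ny)// ler_piMl.
Qed.

End LocalNorm.

(** * From the AM property to a U_0-valued norm *)

Section AMToNorm.
Context {R : realType} {k : scalar_kind} {Omega : topologicalType}.
Hypothesis hausdorff_Omega : hausdorff_space Omega.
Hypothesis lc_Omega : locally_compact [set: Omega].
Context {Gamma : completeNormedModType (scalar_field R k)}.
Variable M : banach_module Omega Gamma.
Implicit Types (f g : C0 Omega (scalar_field R k)) (F G H : C0 Omega R).
Implicit Types (s t : Gamma) (x y : Omega).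
Local Notation localnorm := (localnorm M).

Lemma cap_contraction (c a b : R) :
  `|Num.min a c - Num.min b c| <= `|a - b|.
Proof.
rewrite /Num.min; case: (ltP a c) => ac; case: (ltP b c) => bc //.
- by rewrite ler_normr; case: (ger0P (a - c)) => ?; apply/orP; right; lra.
- by rewrite ler_normr; case: (ger0P (c - b)) => ?; apply/orP; left; lra.
- by rewrite subrr normr0.
Qed.

Definition capC0 (c : R) (c0 : 0 <= c) F : C0 Omega R :=
  MkC0 (@c0_contraction R Omega RealScalars RealScalars (fun a => Num.min a c)
    (min_l c0) (cap_contraction c) F).

Lemma act_mul F f s : act M F (M f s) = M (C0_mul (embC0 k F) f) s.
Proof. by rewrite /act mact_mul. Qed.

(** [t] is approximated by [G t] as soon as [1 - G] is small where [H] is not.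
This property is stable under sums, and so passes from the elements [f s] to
their linear span. *)
Definition unit_controlled t :=
  exists H (S : R), [/\ forall x, 0 <= H x, 0 <= S &
  forall G (d : R), 0 <= d -> (forall x, G x <= 1) ->
    (forall x, (1 - G x) * H x <= d) -> rnorm (t - act M G t) <= d * S].

Lemma unit_controlledD t1 t2 :
  unit_controlled t1 -> unit_controlled t2 -> unit_controlled (t1 + t2).
Proof.
move=> [H1 [S1 [H10 S10 h1]]] [H2 [S2 [H20 S20 h2]]].
exists (H1 + H2), (S1 + S2); split.
- by move=> x; rewrite C0DE addr_ge0.
- exact: addr_ge0.
move=> G d d0 G1 GH; rewrite /act mactDr mulrDr.
apply: le_trans (rnorm_distD _ _ _ _) _; rewrite lerD//.
  apply: h1 => // x; apply: le_trans (GH x).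
  by rewrite C0DE ler_wpM2l ?subr_ge0// lerDl.
apply: h2 => // x; apply: le_trans (GH x).
by rewrite C0DE ler_wpM2l ?subr_ge0// lerDr.
Qed.

Lemma unit_controlled_mact f s : unit_controlled (M f s).
Proof.
exists (absC0 f), (rnorm s); split.
- by move=> x; exact: mod_ge0.
- exact: rnorm_ge0.
move=> G d d0 G1 GH; rewrite act_mul -mactB.
apply: mact_bounded => // x; apply: le_trans (GH x).
rewrite C0BE /= -[X in X - _]mul1r -mulrBl modM -(rmorph1 (@ofR R k)) -rmorphB.
by rewrite mod_ofR ger0_norm// subr_ge0.
Qed.

(** Take [G = min(H, d) / d], where [H] controls an element [t] of the span of
the elements [f s'] close to [s]: where [H < d], the product [(1 - G) * H] is at
most [d], and elsewhere [G = 1]. *)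
Lemma approximate_unit s (e : R) : 0 < e ->
  exists2 G : C0 Omega R,
    (forall x, 0 <= G x <= 1) & rnorm (s - act M G s) <= e.
Proof.
move=> e0; have e30 : 0 < e / 3 by rewrite divr_gt0.
have : closure (lin [set t | exists f s, t = M f s]) s.
  by rewrite mact_nondegenerate.
move=> /closure_rnormP/(_ _ e30)[_ [n [c [a [Ha ->]]]]].
set t := \sum_(i < n) _ => st.
have [H [S [H0 S0 HG]]] : unit_controlled t.
  apply: (big_ind unit_controlled) => [||i _]; last first.
  - by have [f [s' ->]] := Ha i; rewrite -mactZ; exact: unit_controlled_mact.
  - exact: unit_controlledD.
  - exists 0, 0; split => // G d _ _ _.
    by rewrite /act mactr0 subrr rnorm0 mulr0.
have d0 : 0 < e / 3 / (S + 1) by rewrite divr_gt0// ltr_wpDl.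
set d := e / 3 / (S + 1) in d0.
pose G := d^-1 *: capC0 (ltW d0) H.
have GE x : G x = Num.min (H x) d / d by rewrite /G C0ZE mulrC.
have G01 x : 0 <= G x <= 1.
  rewrite GE divr_ge0 ?le_min ?H0 ?(ltW d0)//=.
  by rewrite ler_pdivrMr// mul1r ge_min lexx orbT.
exists G => //.
have tG : rnorm (t - act M G t) <= e / 3.
  apply: (@le_trans _ _ (d * S)).
    apply: HG => [|x|x]; first exact: ltW.
      by have /andP[] := G01 x.
    rewrite GE /Num.min; case: ltP => Hd; last first.
      by rewrite divff ?lt0r_neq0// subrr mul0r ltW.
    rewrite -[leRHS]mul1r ler_pM ?(ltW Hd)//.
      by rewrite subr_ge0 ler_pdivrMr// mul1r ltW.
    by rewrite gerBl divr_ge0 ?(ltW d0).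
  rewrite /d mulrAC ler_pdivrMr ?ltr_wpDl// ler_wpM2l ?(ltW e30)//.
  by rewrite lerDl.
have h : rnorm (act M G (s - t)) <= rnorm (s - t).
  rewrite -[leRHS]mul1r /act; apply: mact_bounded => // x.
  by rewrite /= mod_ofR; have /andP[G0 G1] := G01 x; rewrite ger0_norm.
rewrite /act mactBr in h.
have h1 := rnorm_dist s t (act M G s).
have h2 := rnorm_dist t (act M G t) (act M G s).
rewrite (rnormB (act M G t)) /act in h2.
by rewrite /act in h1 tG *; lra.
Qed.

(** If [F] peaks at [x] and [F s] is small, then [F / F y] competes in the
infimum at [y], for [y] near [x]. *)
Lemma usc_localnorm s : upper_semicontinuous (localnorm s).
Proof.
move=> x a; rewrite lte_fin ltrNr => sa.
have [F [F0 Fx Fs]] := localnorm_lt hausdorff_Omega lc_Omega sa.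
set r := rnorm (act M F s) in Fs; have r0 : 0 <= r := rnorm_ge0 _.
have b0 : 0 < - a := le_lt_trans r0 Fs.
exists [set y | r < - a * F y].
  have cF : continuous (fun y => - a * F y).
    exact: (@continuous_C0 _ _ (- a *: F)).
  apply: (cF x [set z | r < z]); apply: open_nbhs_nbhs.
  split; first exact: open_gt.
  by rewrite /= Fx mulr1.
move=> y /= ry; rewrite lte_fin ltrNr.
have Fy : 0 < F y by rewrite -(pmulr_rgt0 _ b0) (le_lt_trans r0).
apply: (@le_lt_trans _ _ (rnorm (act M ((F y)^-1 *: F) s))).
  apply: localnorm_le; first by move=> z; rewrite C0ZE mulr_ge0// invr_ge0 ltW.
  by rewrite C0ZE mulVf// lt0r_neq0.
rewrite actZ rnormZ mod_ofR gtr0_norm ?invr_gt0//.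
by rewrite ltr_pdivrMl// mulrC.
Qed.

(** The minimum of two competitors at [x] competes for the sum, and it is
dominated by each of them. *)
Lemma localnorm_triangle s1 s2 x :
  localnorm (s1 + s2) x <= localnorm s1 x + localnorm s2 x.
Proof.
rewrite -lerBlDr; apply: localnorm_ge => // F F0 Fx.
rewrite lerBlDr -lerBlDl; apply: localnorm_ge => // G G0 Gx.
rewrite lerBlDl; pose H := - maxC0 (- F) (- G).
have HE y : H y = Num.min (F y) (G y).
  change (- Num.max (- F y) (- G y) = Num.min (F y) (G y)).
  by rewrite oppr_max !opprK.
apply: (@le_trans _ _ (rnorm (act M H (s1 + s2)))).
  apply: localnorm_le; first by move=> y; rewrite HE le_min F0 G0.
  by rewrite HE Fx Gx minxx.
rewrite {1}/act mactDr (le_trans (rnormD _ _))// lerD//; apply: act_le => y.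
- by rewrite HE le_min F0 G0.
- by rewrite HE ge_min lexx.
- by rewrite HE le_min F0 G0.
- by rewrite HE ge_min lexx orbT.
Qed.

(** Multiplying [F] by a peak function [G] supported where |f| < |f x| + e gives
a competitor whose product with [f] is dominated by (|f x| + e) F. *)
Lemma localnorm_mact_le f s x F : (forall y, 0 <= F y) -> F x = 1 ->
  localnorm (M f s) x <= re `|f x| * rnorm (act M F s).
Proof.
move=> F0 Fx; apply: (@ler_addMgt0 _ (rnorm (act M F s))).
  exact: rnorm_ge0.
move=> e e0; rewrite [_ * e]mulrC -mulrDl.
have xU : nbhs x [set y | absC0 f y < re `|f x| + e].
  apply: (@continuous_C0 _ _ (absC0 f) x [set z | z < re `|f x| + e]).
  apply: open_nbhs_nbhs.
  by split; [exact: open_lt|rewrite /= ltrDl].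
have [G [G01 Gx GU]] := peak_function (R := R) hausdorff_Omega lc_Omega xU.
have G0 y : 0 <= G y by have /andP[] := G01 y.
have G1 y : G y <= 1 by have /andP[] := G01 y.
apply: (@le_trans _ _ (rnorm (act M (C0_mul F G) (M f s)))).
  by apply: localnorm_le => [y|] /=; rewrite ?mulr_ge0// Fx Gx mulr1.
have c0 : 0 <= re `|f x| + e by rewrite addr_ge0 ?mod_ge0// ltW.
rewrite -[X in X * _](ger0_norm c0) -(@mod_ofR R k) -rnormZ -mactZ act_mul.
apply: mact_dominated => y; set c := re `|f x| + e in c0 *.
change (re `|ofR (F y * G y) * f y| <=
  re `|ofR c * ofR (F y) : scalar_field R k|).
rewrite !modM !mod_ofR (ger0_norm c0) (ger0_norm (F0 y)).
rewrite ger0_norm ?mulr_ge0// [leRHS]mulrC.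
have [Uy|nUy] := pselect (absC0 f y < re `|f x| + e); last first.
  by rewrite GU// mulr0 mul0r mulr_ge0.
by rewrite ler_pM ?mod_ge0 ?mulr_ge0 ?ler_piMr// ltW.
Qed.

(** For the lower bound, a competitor [F] for [M f s] gives the competitor
|f| F / |f x| for [s]. *)
Lemma localnorm_mact f s x :
  localnorm (M f s) x = re `|f x| * localnorm s x.
Proof.
have := mod_ge0 (f x); rewrite le_eqVlt => /orP[/eqP fx0|fx0].
  apply/eqP; rewrite -fx0 mul0r eq_le localnorm_ge0// andbT.
  have [F [F01 Fx _]] :=
    @peak_function R _ hausdorff_Omega lc_Omega x setT filterT.
  have F0 y : 0 <= F y by have /andP[] := F01 y.
  by have := localnorm_mact_le f s F0 Fx; rewrite -fx0 mul0r.
apply/eqP; rewrite eq_le; apply/andP; split.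
  rewrite -ler_pdivrMl//; apply: localnorm_ge => // F F0 Fx.
  by rewrite ler_pdivrMl//; exact: localnorm_mact_le.
apply: localnorm_ge => // F F0 Fx; rewrite -ler_pdivlMl//.
pose H := (re `|f x|)^-1 *: C0_mul F (absC0 f).
apply: (@le_trans _ _ (rnorm (act M H s))).
  apply: localnorm_le => [y|]; rewrite /H C0ZE /=.
    by rewrite !mulr_ge0 ?mod_ge0// invr_ge0 mod_ge0.
  by rewrite Fx mul1r mulVf// lt0r_neq0.
rewrite /H actZ rnormZ mod_ofR gtr0_norm ?invr_gt0//.
rewrite ler_wpM2l ?invr_ge0 ?mod_ge0// act_mul; apply: act_le_mact => y /=.
by rewrite normrM modM mod_ofR [X in _ * X]ger0_norm ?mod_ge0.
Qed.

Lemma localnorm_le_rnorm s x : localnorm s x <= rnorm s.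
Proof.
have [F [F01 Fx _]] :=
    @peak_function R _ hausdorff_Omega lc_Omega x setT filterT.
have F0 y : 0 <= F y by have /andP[] := F01 y.
apply: le_trans (localnorm_le M s F0 Fx) _.
rewrite -[leRHS]mul1r /act; apply: mact_bounded => // y /=.
by rewrite mod_ofR ger0_norm//; have /andP[] := F01 y.
Qed.

(** [s] is close to some [G s], and [localnorm (G s) = |G| * localnorm s]. *)
Lemma vanishing_localnorm s : vanishes_at_infinity (localnorm s).
Proof.
move=> e e0; have e20 : 0 < e / 2 by rewrite divr_gt0.
have [G G01 sG] := approximate_unit s e20.
have [_ vG] := (c0P _).1 (C0_in G).
have s0 := rnorm_ge0 s.
have d0 : 0 < rnorm s + 1 by rewrite ltr_wpDl.
have [L cL LG] := vG (e / 2 / (rnorm s + 1)) (divr_gt0 e20 d0).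
exists L => // x /LG Gx; rewrite ger0_norm ?localnorm_ge0//.
rewrite -(subrK (act M G s) s); apply: le_trans (localnorm_triangle _ _ _) _.
rewrite [leRHS]splitr; apply: lerD.
  exact: le_trans (localnorm_le_rnorm _ _) sG.
rewrite {1}/act localnorm_mact /= mod_ofR.
apply: (@le_trans _ _ (e / 2 / (rnorm s + 1) * (rnorm s + 1))).
  rewrite ler_pM ?localnorm_ge0// (le_trans (localnorm_le_rnorm _ _))//.
  by rewrite lerDl.
by rewrite divfK ?lt0r_neq0.
Qed.

Hypothesis AM : AM_module M.

Lemma AM_max s F G : (forall x, 0 <= F x) -> (forall x, 0 <= G x) ->
  rnorm (act M (maxC0 F G) s) = Num.max (rnorm (act M F s)) (rnorm (act M G s)).
Proof.
move=> F0 G0; have [_] := AM s; apply; [exact: cone_act|exact: cone_act|].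
exact: lub_act.
Qed.

(** Compactness is used as near covering along the filter of the functions
[G >= F], where [F] ranges over the nonnegative functions with [F s] of norm
less than [b].  The AM property makes this family directed. *)
Lemma compact_cover_max s (b : R) (L : set Omega) : compact L ->
  (forall x, localnorm s x < b) -> 0 < b ->
  exists F, [/\ forall x, 0 <= F x, rnorm (act M F s) < b &
    forall x, L x -> 1 < F x].
Proof.
move=> /compact_near_coveringP cL sb b0.
pose good : set (C0 Omega R) :=
  [set F : C0 Omega R | (forall x, 0 <= F x) /\ rnorm (act M F s) < b].
pose Fl := filter_from good
  (fun F : C0 Omega R => [set G : C0 Omega R | good G /\ forall x, F x <= G x]).
have FlF : Filter Fl.
  apply: filter_from_filter.
    by exists 0; split => //; rewrite act0 rnorm0.
  move=> F G [F0 Fb] [G0 Gb]; exists (maxC0 F G).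
    split; first by move=> x; rewrite /= le_max F0.
    by rewrite AM_max// gt_max Fb Gb.
  move=> H [gH GH]; split; split => // x; apply: le_trans (GH x);
    by rewrite /= le_max lexx ?orbT.
have [|F [F0 Fb] FL] := cL _ Fl (fun (F : C0 Omega R) x => 1 < F x) FlF;
  last first.
  by exists F; split => //; apply: FL.
move=> x Lx.
have [F [F0 Fx Fs]] := localnorm_lt hausdorff_Omega lc_Omega (sb x).
set r := rnorm _ in Fs; have r0 : 0 <= r := rnorm_ge0 _.
(* A factor c > 1 small enough to keep c * r < b; c F then exceeds 1 near x. *)
pose c := 1 + (b - r) / (2 * b).
have c1 : 1 < c by rewrite ltrDl divr_gt0 ?subr_gt0// mulr_gt0.
have cb : c * r < b.
  have e1 : (b - r) / (2 * b) * b = (b - r) / 2 by field; rewrite lt0r_neq0.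
  have : (b - r) / (2 * b) * r <= (b - r) / (2 * b) * b.
    by rewrite ler_wpM2l ?(ltW Fs)// divr_ge0 ?subr_ge0 ?ltW// mulr_gt0.
  by rewrite e1 [c * r]mulrDl mul1r; lra.
exists ([set y | 1 < (c *: F) y],
  [set G : C0 Omega R | good G /\ forall y, (c *: F) y <= G y]).
  split => /=.
    apply: (@continuous_C0 _ _ (c *: F) x [set z | 1 < z]).
    apply: open_nbhs_nbhs.
    by split; [exact: open_gt|change (1 < c * F x); rewrite Fx mulr1].
  exists (c *: F) => //; split.
    by move=> y; rewrite C0ZE mulr_ge0// ltW// (lt_trans ltr01).
  by rewrite actZ rnormZ mod_ofR gtr0_norm// (lt_trans ltr01).
by move=> [y G] /= [y1 [_ cG]]; exact: lt_le_trans y1 (cG y).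
Qed.

(** Let [G] be an approximate unit for [s], at most [e] outside the compact [L],
and let [F > 1] on [L] with |F s| < a + e.  Then [G <= max(F, min(G, e))], and
the AM property bounds |G s| by the larger of [a + e] and [e |s|]. *)
Lemma rnorm_le_localnorm s (a : R) : 0 <= a ->
  (forall x, localnorm s x <= a) -> rnorm s <= a.
Proof.
move=> a0 sa; have s0 := rnorm_ge0 s.
apply: (@ler_addMgt0 _ (2 + rnorm s)); first by rewrite addr_ge0.
move=> e e0; have [G G01 sG] := approximate_unit s e0.
have G0 x : 0 <= G x by have /andP[] := G01 x.
have [_ vG] := (c0P _).1 (C0_in G).
have [L cL LG] := vG e e0.
have b0 : 0 < a + e by rewrite ltr_wpDl.
have sb x : localnorm s x < a + e by rewrite (le_lt_trans (sa x))// ltrDl.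
have [F [F0 Fs FL]] := compact_cover_max cL sb b0.
have h : rnorm (act M G s) <= Num.max (rnorm (act M F s))
    (rnorm (act M (capC0 (ltW e0) G) s)).
  rewrite -AM_max//; last by move=> x; rewrite /= le_min G0 ltW.
  apply: act_le => // x; rewrite /= le_max.
  have [/FL Fx|/LG Gx] := pselect (L x).
    by have /andP[_ G1] := G01 x; rewrite (le_trans G1)// ltW.
  by rewrite le_min lexx (le_trans (ler_norm _) Gx) orbT.
have h2 : rnorm (act M (capC0 (ltW e0) G) s) <= e * rnorm s.
  rewrite /act; apply: mact_bounded; first exact: ltW.
  move=> x /=; rewrite mod_ofR ger0_norm; last by rewrite le_min G0 ltW.
  by rewrite ge_min lexx orbT.
have h3 := rnorm_le_dist s (act M G s).
have h4 : rnorm (act M G s) <= a + e + e * rnorm s.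
  apply: le_trans h _; rewrite ge_max; apply/andP; split.
    by rewrite (le_trans (ltW Fs))// lerDl mulr_ge0// ltW.
  by rewrite (le_trans h2)// lerDr ltW.
lra.
Qed.

Lemma localnorm_U0norm : U0_valued_norm M localnorm.
Proof.
split.
- move=> s; split; last by move=> x; exact: localnorm_ge0.
  by split; [exact: usc_localnorm|exact: vanishing_localnorm].
- move=> s; apply/eqP; rewrite eq_le; apply/andP; split.
    apply: sup_norm_le => [|x]; first exact: rnorm_ge0.
    by rewrite ger0_norm ?localnorm_ge0// localnorm_le_rnorm.
  have bd x : localnorm s x <= sup_norm (localnorm s).
    rewrite /sup_norm; apply: le_trans (ler_norm _) _.
    apply: ub_le_sup; last by exists x.
    exists (rnorm s) => _ [y _ <-].
    by rewrite ger0_norm ?localnorm_ge0// localnorm_le_rnorm.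
  apply: rnorm_le_localnorm => //; exact: sup_norm_ge0.
- by move=> f s x; exact: localnorm_mact.
- by move=> s1 s2 x; exact: localnorm_triangle.
Qed.

End AMToNorm.
Theorem proposition5p3 (R : realType) (k : scalar_kind)
    (Omega : topologicalType)
    (hausdorff_Omega : hausdorff_space Omega)
    (locally_compact_Omega : locally_compact [set: Omega])
    (Gamma : completeNormedModType (scalar_field R k))
    (M : banach_module Omega Gamma) :
  (AM_module M <-> exists N : Gamma -> Omega -> R, U0_valued_norm M N) /\
  (AM_module M ->
    (exists! N : Gamma -> Omega -> R, U0_valued_norm M N) /\
    forall N : Gamma -> Omega -> R, U0_valued_norm M N ->
      forall s x, N s x =
        inf [set rnorm (M f s) | f in
               [set f : C0 Omega (scalar_field R k) | C0_nonneg f /\ f x = 1]]).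
Proof.
have formula N s x : U0_valued_norm M N -> N s x = localnorm M s x.
  exact: U0norm_localnorm.
have AM_norm : AM_module M -> U0_valued_norm M (localnorm M).
  exact: localnorm_U0norm.
split; first split=> [AM|[N HN]].
- by exists (localnorm M); exact: AM_norm.
- exact: U0norm_AM_module HN.
- move=> AM; split=> [|N HN s x]; last exact: formula.
  exists (localnorm M); split=> [|N HN]; first exact: AM_norm.
  by apply/funext => s; apply/funext => x; rewrite formula.
Qed.
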